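(* Let $p=p(n)$ be any function with $0\le p(n)\le 1$, and let $G\sim G(n,p)$, where $n$ is even. Then, as $n\to\infty$ through even integers, $$\Pr(G\text{ contains no perfect matching})=(1+o(1))\Pr(\delta(G)=0).$$
   Context: $G(n,p)$ is the binomial (Erdős–Rényi) random graph on $n$ labelled vertices, in which each of the $\binom n2$ possible edges is present independently with probability $p$. $\delta(G)$ is the minimum degree of $G$. A perfect matching is a set of pairwise disjoint edges covering all vertices. The notation $a_n=(1+o(1))b_n$ means that there is a sequence $\varepsilon_n\to 0$ as $n\to\infty$ with $a_n=(1+\varepsilon_n)b_n$. *)

(* Defs.v *)
From HB Require Import structures.
From mathcomp Require Import all_boot all_order all_algebra.
From mathcomp Require Import reals.

Set Implicit Arguments.
Unset Strict Implicit.
Unset Printing Implicit Defensive.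

Import Order.TTheory GRing.Theory Num.Theory.

Local Open Scope ring_scope.

(* MathComp with MathComp-Analysis; the classical library is not imported here
   because it shadows the finset versions of trivIset and cover. *)

(* A simple graph with vertex set T is given by its edge set G, a set of
   2-element subsets of T: G \subset all_edges T. *)
Definition all_edges (T : finType) : {set {set T}} :=
  [set e : {set T} | #|e| == 2%N].

Definition degree (T : finType) (G : {set {set T}}) (v : T) : nat :=
  #|[set e in G | v \in e]|.

(* The unit #|T| of the iterated minimum is larger than every degree of a graph
   on T, so it does not affect the value as soon as T is nonempty. *)
Definition min_degree (T : finType) (G : {set {set T}}) : nat :=
  \big[minn/#|T|]_(v : T) degree G v.

Definition perfect_matching (T : finType) (G M : {set {set T}}) : bool :=
  [&& M \subset G, trivIset M & cover M == [set: T]].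

Definition has_perfect_matching (T : finType) (G : {set {set T}}) : bool :=
  [exists M : {set {set T}}, perfect_matching G M].

(* Independence of the edges is encoded by the product form of the mass
   function. *)
Definition gnp_mass (R : realType) (n : nat) (p : R) (G : {set {set 'I_n}}) : R :=
  \prod_(e in all_edges 'I_n) (if e \in G then p else 1 - p).

Definition gnp_pr (R : realType) (n : nat) (p : R)
    (A : {set {set 'I_n}} -> bool) : R :=
  \sum_(G in powerset (all_edges 'I_n) | A G) gnp_mass p G.

(* Main.v *)
Require Import Defs.
From HB Require Import structures.
From mathcomp Require Import all_boot all_order all_algebra.
From mathcomp Require Import all_classical all_reals all_analysis.
From mathcomp Require Import fintype finset zify ring lra.

Set Implicit Arguments.
Unset Strict Implicit.
Unset Printing Implicit Defensive.

Import Order.TTheory GRing.Theory Num.Theory.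
Import numFieldNormedType.Exports.

(** Write q = 1 - p and mu = n q^(n-1), the expected number of isolated
    vertices.  A graph with an isolated vertex has no perfect matching, so the
    theorem says that the event {no perfect matching, no isolated vertex} has
    probability o(Pr(min degree = 0)), uniformly in p.

    The second moment method, [gnp_pr_isolated_sq], controls Pr(min degree = 0)
    from below.  Fix a large constant kap.  If mu >= e^kap then p is
    small ([density_le]) and the event {no isolated vertex} is itself unlikely
    ([min_degree_pr_upper]).  If mu <= e^kap then
    Pr(min degree = 0) is at least a constant times mu ([isolated_pr_lower]),
    and it remains to bound the exceptional event by o(mu).

    That bound is a union bound over obstructions, which Tutte's theorem
    ([tutte]) provides: a set S whose removal leaves more than #|S| odd pieces,
    hence, n being even, at least #|S| + 2 of them.  Either two large sets span
    no edge between them, which has probability at most 4^n q^(c n^2 / log n);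
    or one piece is large and the union W of the others is small, with
    #|S| < #|W| and no edge from W to the vertices outside S and W.  Dropping
    superfluous vertices from S one arranges that each vertex of S has two
    neighbours in W ([no_matching_obstruction]).  With s = #|S| and t = #|W| the
    expected number of such pairs is at most
      'C(n, s) 'C(n, t) t^(2 s) p^(2 s) q^(t (n - s - t)),
    which, since q^n is at most of order 1/n, is about mu (n p^2)^s up to
    factors c^t and factorials: the two edges at each vertex of S pay for the
    n^s choices of S.  When S is empty the gain comes from an edge inside W,
    present because no vertex is isolated.

    No upper bound on p is available when q^n is small, so powers of p are
    never estimated alone: the inequality p q^m <= 1 / (m + 1), used with m
    close to n / 8, trades each factor p for a factor 8 / n at the price of a
    fraction of the exponent of q ([trapped_term_le]). *)

(** * Tutte's theorem *)

Section Pairings.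
Variable T : finType.
Implicit Types (G H : {set {set T}}) (A B S U W : {set T}) (f : T -> T).

(** Perfect matchings are handled as fixed-point free involutions: alternating
    walks are then iterates of the composition of two functions. *)
Definition pairing_on G U f : Prop :=
  forall x, x \in U -> [/\ f x \in U, f (f x) = x & [set x; f x] \in G].

Definition pairable G : bool :=
  [exists f : {ffun T -> T}, [forall x, (f (f x) == x) && ([set x; f x] \in G)]].

Lemma edge_neq G x y : G \subset all_edges T -> [set x; y] \in G -> x != y.
Proof.
move=> /subsetP sG /sG; by rewrite inE cards2; case: (x =P y).
Qed.

Lemma set2C (x y : T) : [set x; y] = [set y; x].
Proof. by rewrite finset.setUC. Qed.

Lemma pairableP G : reflect (exists f, pairing_on G [set: T] f) (pairable G).
Proof.
apply: (iffP existsP) => [[f /forallP hf]|[f hf]].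
  by exists f => x _; have /andP[/eqP ffx xE] := hf x; rewrite inE.
exists [ffun x => f x]; apply/forallP => x; rewrite !ffunE.
by have [_ -> ->] := hf x (in_setT x); rewrite eqxx.
Qed.

Lemma pairable_perfect_matching G :
  pairable G -> has_perfect_matching G.
Proof.
case/pairableP => f hf.
have ff x : f (f x) = x by have [] := hf x (in_setT x).
apply/existsP; exists [set [set x; f x] | x in T]; apply/and3P; split.
- by apply/subsetP => _ /imsetP[x _ ->]; have [] := hf x (in_setT x).
- apply/trivIsetP => _ _ /imsetP[x _ ->] /imsetP[y _ ->] neq.
  rewrite -setI_eq0; apply: contraNT neq => /set0Pn[z].
  rewrite !inE => /andP[] /orP[]/eqP-> /orP[]/eqP e.
  + by rewrite e.
  + by rewrite e ff set2C.
  + by rewrite -e ff set2C.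
  + by rewrite -(ff x) e ff.
- apply/eqP/setP => x; rewrite inE; apply/bigcupP; exists [set x; f x].
    exact: imset_f.
  by rewrite !inE eqxx.
Qed.

Lemma pairing_add_edge G U f x y : x != y -> x \in U -> y \in U ->
    [set x; y] \in G -> pairing_on G (U :\: [set x; y]) f ->
  exists f', pairing_on G U f'.
Proof.
move=> nxy xU yU xyG hf.
exists (fun z => if z == x then y else if z == y then x else f z) => z zU /=.
have [->|nzx] := eqVneq z x; first by rewrite [y == x]eq_sym (negPf nxy) eqxx.
have [->|nzy] := eqVneq z y; first by rewrite eqxx set2C.
have [|+ ffz zG] := hf z; first by rewrite !inE negb_or nzx nzy zU.
rewrite !inE negb_or => /andP[/andP[/negPf-> /negPf->] ->].
by split.
Qed.

(** A pairing of the enlarged graph that avoided the new edge would already be a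
    pairing of [H]. *)
Lemma pairable_new_edge H a c : ~~ pairable H -> pairable ([set a; c] |: H) ->
  exists f, [/\ (forall x, f (f x) = x), f a = c &
    forall x, x != a -> x != c -> [set x; f x] \in H].
Proof.
move=> nH /pairableP[f hf].
have ff x : f (f x) = x by have [] := hf x (in_setT x).
have fE x : [set x; f x] \in [set a; c] |: H by have [] := hf x (in_setT x).
exists f; split => //.
- apply/eqP; apply: contraNT nH => fac; apply/pairableP; exists f => x _.
  split=> //; have := fE x; rewrite inE => /orP[]; last by [].
  rewrite inE => /eqP e.
  have := set21 x (f x); rewrite e => /set2P[] xE.
    have := set22 a c; rewrite -e xE => /set2P[] cE; last by rewrite -cE eqxx in fac.
    by rewrite cE in fac; have := set22 x (f x); rewrite e xE cE setUid inE (negPf fac).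
  have := set21 a c; rewrite -e xE => /set2P[] aE; last by rewrite aE ff eqxx in fac.
  by rewrite aE in fac; have := set22 x (f x); rewrite e xE aE setUid inE (negPf fac).
- move=> x xa xc; have := fE x; rewrite inE => /orP[]; last by [].
  rewrite inE => /eqP/setP /(_ x); rewrite !inE eqxx /= => /esym.
  by rewrite (negPf xa) (negPf xc).
Qed.

(** After cancelling the two adjacent [f2], an odd number of alternating
    involutions remains, which is a conjugate of [f1] or [f2] and therefore has no
    fixed point. *)
Lemma odd_walk_neq f1 f2 i x :
  (forall x, f1 (f1 x) = x) -> (forall x, f2 (f2 x) = x) ->
  (forall x, f1 x != x) -> (forall x, f2 x != x) ->
  f2 (iter i (fun y => f2 (f1 y)) x) != x.
Proof.
move=> f1K f2K n1 n2; elim/ltn_ind: i x => -[|[|i]] IH x; first exact: n2.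
  by rewrite /= f2K.
rewrite iterS f2K iterSr; set y := f2 (f1 x).
apply: contraNneq (IH i (leqnSn _) y) => e.
by rewrite -[iter i _ y]f1K e.
Qed.

(** Lovasz's argument: in an edge-maximal graph without perfect matching,
    adjacency is transitive through a vertex [b] that is not universal.  Let
    [f1], [f2] be perfect matchings of the graph with the edge a c, respectively
    b d, added.  Follow the alternating walk from [d], starting with [f1].
    If it closes up before meeting a or c, switch to [f1] on the cycle and keep
    [f2] elsewhere.  If it meets [z], one of a and c, first, use [f1] on
    the walk before [z], then the edge z b, and [f2] elsewhere.  Neither
    involution uses a c or b d. *)
Lemma lovasz_step H a b c d : H \subset all_edges T -> ~~ pairable H ->
    (forall e, e \in all_edges T -> e \notin H -> pairable (e |: H)) ->
    [set a; b] \in H -> [set b; c] \in H -> a != c -> [set a; c] \notin H ->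
  d != b -> [set b; d] \in H.
Proof.
move=> sH nH maxH abH bcH nac acH ndb; apply: contraT => bdH.
have [|f1 [f1K f1a f1H]] := @pairable_new_edge H a c nH.
  by apply: maxH; rewrite // inE cards2 nac.
have [|f2 [f2K f2b f2H]] := @pairable_new_edge H b d nH.
  by apply: maxH; rewrite // inE cards2 (eq_sym b) ndb.
have n1 x : f1 x != x.
  have [->|xa] := eqVneq x a; first by rewrite f1a eq_sym.
  have [->|xc] := eqVneq x c; first by rewrite -f1a f1K f1a.
  by rewrite eq_sym; apply: edge_neq sH (f1H x xa xc).
have n2 x : f2 x != x.
  have [->|xa] := eqVneq x b; first by rewrite f2b.
  have [->|xc] := eqVneq x d; first by rewrite -f2b f2K eq_sym f2b.
  by rewrite eq_sym; apply: edge_neq sH (f2H x xa xc).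
have nba : b != a by rewrite eq_sym (edge_neq sH abH).
have nbc : b != c by rewrite (edge_neq sH bcH).
pose g y := f2 (f1 y); pose w i := iter i g d.
have f2d : f2 d = b by rewrite -f2b f2K.
have f1c : f1 c = a by rewrite -f1a f1K.
have wS i : f2 (f1 (w i)) = w i.+1 by [].
have f2wS i : f2 (w i.+1) = f1 (w i) by rewrite -wS f2K.
pose stop k := (w k \in [set a; c]) || (w k.+1 == d).
(* [w] enumerates every other vertex of the walk; the walk can meet a or c
   first only at such a vertex, because [f1] exchanges a and c. *)
have [K stopK minK] : exists2 K, stop K & forall i, i < K -> ~~ stop i.
  have exK : exists K, stop K.
    have ginj : injective g by move=> x y /(congr1 f2); rewrite /g !f2K => /(congr1 f1); rewrite !f1K.
    exists (order g d).-1; apply/orP; right.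
    by rewrite prednK ?order_gt0 // /w iter_order.
  by have [K sK mK] := ex_minnP exK; exists K => // i; rewrite ltnNge; apply: contraNN => /mK.
(* [Y k] is the set of the first 2 k vertices of the walk. *)
pose Y k := [set x | [exists i : 'I_k, (x == w i) || (x == f1 (w i))]].
have YP k x : reflect (exists2 i, i < k & x = w i \/ x = f1 (w i)) (x \in Y k).
  rewrite inE; apply: (iffP existsP) => [[i /orP[]/eqP ->]|[i ik e]].
  - by exists i => //; left.
  - by exists i => //; right.
  - by exists (Ordinal ik); case: e => ->; rewrite eqxx ?orbT.
have Yf1 k x : x \in Y k -> f1 x \in Y k.
  by move=> /YP[i ik [] ->]; apply/YP; exists i => //; [right|left; rewrite f1K].
have Yac k x : (forall i, i < k -> w i \notin [set a; c]) -> x \in Y k ->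
    [set x; f1 x] \in H.
  move=> h /YP[i ik xE]; have := h i ik; rewrite !inE negb_or => /andP[wa wc].
  case: xE => ->; first exact: f1H.
  rewrite f1K set2C; exact: f1H.
have Kac i : i < K -> w i \notin [set a; c].
  by move=> /minK; rewrite negb_or => /andP[].
have bH z : z \in [set a; c] -> [set z; b] \in H.
  by case/set2P => ->//; rewrite set2C.
suff : pairable H by rewrite (negPf nH).
apply/pairableP.
have [wK|wK] := boolP (w K \in [set a; c]).
- pose z := w K; rewrite -/z in wK.
  have nzb : z != b by case/set2P: wK => ->; rewrite eq_sym.
  have zY : z \notin Y K.
    apply/negP => /YP[i iK [e|e]]; have := Kac i iK; first by rewrite -e wK.
    rewrite -(f1K (w i)) -e; case/set2P: wK => ->; rewrite ?f1a ?f1c;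
    by rewrite !inE eqxx ?orbT.
  have bY : b \notin Y K.
    apply/negP => /YP[i iK [e|e]].
      have := @odd_walk_neq f1 f2 i d f1K f2K n1 n2.
      by rewrite -/g -/(w i) -e f2b eqxx.
    by have := minK i iK; rewrite /stop -wS -e f2b eqxx orbT.
  have dYz : (d \in Y K) || (d == z).
    case: (posnP K) => [K0|K0]; first by rewrite /z K0 eqxx orbT.
    by rewrite (_ : d \in Y K) //; apply/YP; exists 0 => //; left.
  have f2out x : x \notin Y K -> x != z -> x != b ->
      [/\ f2 x \notin Y K, f2 x != z & f2 x != b].
    move=> xY xz xb; split.
    + apply/negP => /YP[i iK [e|e]].
        case: i iK e => [|i] iK e.
          by case/eqP: xb; rewrite -(f2K x) e.
        case/negP: xY; apply/YP; exists i; first exact: ltnW.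
        by right; rewrite -f2wS -e f2K.
      have xE : x = w i.+1 by rewrite -wS -e f2K.
      case: (ltngtP i.+1 K) => [h|h|h].
      * by case/negP: xY; apply/YP; exists i.+1 => //; left.
      * by rewrite ltnNge iK in h.
      * by rewrite xE h eqxx in xz.
    + apply/negP => /eqP e; have {e}: x = f2 (w K) by rewrite -/z -e f2K.
      case: (K) (zY) xY => [|k] _ xY e; first by rewrite e f2d eqxx in xb.
      by case/negP: xY; apply/YP; exists k => //; right; rewrite -f2wS.
    + apply/negP => /eqP e; have xd : x = d by rewrite -f2b -e f2K.
      by move: dYz; rewrite -xd (negPf xY) (negPf xz).
  exists (fun x => if x \in Y K then f1 x else if x == z then b else
                   if x == b then z else f2 x) => x _ /=.
  rewrite inE; have [xY|xY] := boolP (x \in Y K).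
    by rewrite Yf1 // f1K; split=> //; apply: Yac xY.
  have [->|xz] := eqVneq x z.
    by rewrite (negPf bY) eq_sym (negPf nzb) eqxx; split=> //; apply: bH.
  have [->|xb] := eqVneq x b.
    by rewrite (negPf zY) eqxx set2C; split=> //; apply: bH.
  have [/negPf-> /negPf-> /negPf->] := f2out x xY xz xb.
  rewrite f2K; split => //; apply: f2H => //.
  by apply: contraNneq xY => xd; move: dYz; rewrite -xd (negPf xz) orbF.
- have wKd : w K.+1 = d by move: stopK; rewrite /stop (negPf wK) => /eqP.
  have Kac' i : i < K.+1 -> w i \notin [set a; c].
    by rewrite ltnS leq_eqVlt => /orP[/eqP->|/Kac].
  have dY : d \in Y K.+1 by apply/YP; exists 0 => //; left.
  have bY : b \in Y K.+1.
    by apply/YP; exists K => //; right; rewrite -f2d -wKd f2wS.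
  have Yf2 x : x \in Y K.+1 -> f2 x \in Y K.+1.
    move=> /YP[i iK [] ->].
      case: i iK => [|i] iK; first by rewrite f2d.
      by rewrite f2wS; apply/YP; exists i; [exact: ltnW|right].
    rewrite wS; move: iK; rewrite ltnS leq_eqVlt => /orP[/eqP->|iK].
      by rewrite wKd.
    by apply/YP; exists i.+1 => //; left.
  have Yf2' x : x \notin Y K.+1 -> f2 x \notin Y K.+1.
    by apply: contraNN => /Yf2; rewrite f2K.
  exists (fun x => if x \in Y K.+1 then f1 x else f2 x) => x _ /=.
  rewrite inE; have [xY|xY] := boolP (x \in Y K.+1).
    by rewrite Yf1 // f1K; split=> //; apply: Yac xY.
  rewrite (negPf (Yf2' x xY)) f2K; split=> //; apply: f2H.
    by apply: contraNneq xY => ->.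
  by apply: contraNneq xY => ->.
Qed.

Lemma odd_setD2 (A : {set T}) x y : x != y -> x \in A -> y \in A ->
  #|A| = (#|A :\: [set x; y]|).+2.
Proof.
move=> nxy xA yA; rewrite -(cardsID [set x; y] A).
by rewrite (setIidPr _) ?cards2 ?nxy //; apply/subsetP => z /set2P[]->.
Qed.

(** A vertex set whose members in [S] are universal and whose other members fall
    into cliques can be paired off, provided that [S] covers the odd cliques.
    Pairs are removed greedily: first inside a clique, then a left-over vertex
    with a vertex of [S], finally inside [S]; each removal keeps the inequality.
    The subset [U] of vertices still to be paired makes the induction work. *)
Lemma clique_pairing H S (P : {set {set T}}) U :
    finset.partition P (~: S) ->
    (forall s x, s \in S -> x != s -> [set s; x] \in H) ->
    (forall B x y, B \in P -> x \in B -> y \in B -> x != y -> [set x; y] \in H) ->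
    ~~ odd #|U| -> #|[set B in P | odd #|B :&: U|]| <= #|S :&: U| ->
  exists f, pairing_on H U f.
Proof.
move=> partP SH PH; have [n] := ubnP #|U|; elim: n U => // n IH U.
rewrite ltnS => leU evU oddU.
have step x y : x != y -> x \in U -> y \in U -> [set x; y] \in H ->
    #|[set B in P | odd #|B :&: (U :\: [set x; y])|]| <= #|S :&: (U :\: [set x; y])| ->
  exists f, pairing_on H U f.
  move=> nxy xU yU xyH oddU'; have cU := odd_setD2 nxy xU yU.
  have [|||f hf] := IH (U :\: [set x; y]); rewrite ?cU /= ?negbK // in leU evU *.
    by apply: leq_trans leU; rewrite ltnS leqnSn.
  exact: pairing_add_edge nxy xU yU xyH hf.
have PS B x : B \in P -> x \in B -> x \notin S.
  move=> BP xB; have := cover_partition partP => /setP/(_ x).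
  by rewrite !inE => <-; apply/bigcupP; exists B.
have sameP B C x : B \in P -> C \in P -> x \in B -> x \in C -> B = C.
  move=> BP CP xB xC; have [_ /trivIsetP tP _] := and3P partP.
  by apply: contraTeq xC => /(tP _ _ BP CP)/disjointFr/(_ xB) ->.
have [/existsP[B /andP[BP]]|] := boolP [exists B in P, 1 < #|B :&: U|].
  case/card_gt1P => x [y []]; rewrite !inE => /andP[xB xU] /andP[yB yU] nxy.
  apply: (step x y nxy xU yU (PH B x y BP xB yB nxy)).
  have -> : S :&: (U :\: [set x; y]) = S :&: U.
    apply/setP => z; rewrite !inE; case: (boolP (z \in S)) => //= zS.
    have /negPf-> : z != x by apply: contraNneq (PS B x BP xB) => <-.
    by have /negPf-> : z != y by apply: contraNneq (PS B y BP yB) => <-.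
  apply: leq_trans oddU; apply: subset_leq_card; apply/subsetP => C.
  rewrite !inE => /andP[CP]; rewrite CP setIDA /=.
  have [CB|nCB] := eqVneq C B.
    by rewrite [#|C :&: U|](odd_setD2 nxy) ?inE ?CB ?xB ?yB //= negbK.
  rewrite (setDidPl _) // disjoint_sym disjoints_subset.
  apply/subsetP => z /set2P[] ->; rewrite !inE negb_and; apply/orP; left;
  by apply: contraNN nCB => zC; apply/eqP; apply: (sameP _ _ _ CP BP zC).
rewrite negb_exists => /forallP small.
have [/subsetP US|/subsetPn[u uU uS]] := boolP (U \subset S).
  have [->|/set0Pn[x xU]] := eqVneq U set0.
    by exists id => x; rewrite inE.
  have : 1 < #|U|.
    by case: #|U| (cardsD1 x U) evU => [|[]] //; rewrite xU.
  case/card_gt1P => a [b [aU bU nab]].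
  apply: (step a b nab aU bU); first by apply: SH; [exact: US|rewrite eq_sym].
  rewrite [X in X <= _](_ : _ = 0) //; apply/eqP; rewrite cards_eq0.
  apply/eqP/setP => C; rewrite !inE; apply/negP => /andP[CP].
  rewrite (_ : _ :&: _ = set0) ?cards0 //; apply/setP => z; rewrite !inE.
  by apply/negP => /and3P[zC _ /US]; apply/negP; apply: PS zC.
have uc : u \in cover P by rewrite (cover_partition partP) inE.
pose B := pblock P u; have BP : B \in P by apply: pblock_mem.
have uB : u \in B by rewrite mem_pblock.
have BU1 : B :&: U = [set u].
  apply/setP => z; rewrite !inE; apply/andP/eqP => [[zB zU]|->//].
  have := small B; rewrite BP /= -leqNgt => /card_le1_eqP; apply; by rewrite inE ?zB ?uB.
have [s sSU] : exists s, s \in S :&: U.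
  apply/set0Pn; rewrite -card_gt0; apply: leq_trans oddU.
  by apply/card_gt0P; exists B; rewrite inE BP BU1 cards1.
have [sS sU] : s \in S /\ s \in U by move: sSU; rewrite inE => /andP.
have nus : u != s by apply: contraNneq uS => ->.
apply: (step u s nus uU sU); first by rewrite set2C; apply: SH.
have -> : S :&: (U :\: [set u; s]) = (S :&: U) :\ s.
  apply/setP => z; rewrite !inE; case: (eqVneq z u) => [->|_] /=; last by rewrite andbCA.
  by rewrite (negPf uS) /= ?andbF.
move: oddU; rewrite (cardsD1 B) (cardsD1 s (S :&: U)) sSU inE BP BU1 cards1 /= !add1n ltnS.
apply: leq_trans; apply: subset_leq_card; apply/subsetP => C.
rewrite !inE => /andP[CP]; rewrite CP andTb.
have [->|nCB] := eqVneq C B.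
  rewrite setIDA BU1 (_ : _ :\: _ = set0) ?cards0 //.
  by apply/setP => z; rewrite !inE; case: (eqVneq z u); rewrite ?andbF.
rewrite setIDA (setDidPl _) // disjoint_sym disjoints_subset.
apply/subsetP => z /set2P[] ->; rewrite !inE negb_and; apply/orP; left.
  by apply: contraNN nCB => zC; apply/eqP; apply: (sameP _ _ _ CP BP zC).
by apply: contraL sS; apply: PS.
Qed.

Lemma odd_blocks_card (P : {set {set T}}) (A : {set T}) : finset.partition P A ->
  odd #|A| = odd #|[set B in P | odd #|B|]|.
Proof.
move=> partP; rewrite (card_partition partP).
rewrite (eq_bigr (fun B : {set T} => (odd #|B|) + #|B|./2.*2)); last by move=> B _; rewrite odd_double_half.
rewrite big_split /= oddD -[in X in _ (+) X](big_morph _ doubleD double0) odd_double addbF.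
by rewrite -big_mkcondr sum1dep_card; congr odd; apply: eq_card => B; rewrite !inE.
Qed.

(** Apply [lovasz_step] to an edge-maximal graph containing [G] without perfect
    matching, with [S] its set of universal vertices: outside [S] adjacency or
    equality is an equivalence relation, so [S] and its classes satisfy all the
    hypotheses of [clique_pairing] except the inequality.  The classes need not
    be the components of [G] minus [S], only unions of such components. *)
Lemma tutte G : G \subset all_edges T -> ~~ odd #|T| -> ~~ has_perfect_matching G ->
  exists S P, [/\ finset.partition P (~: S),
    forall B x y, B \in P -> x \in B -> [set x; y] \in G -> y \in B :|: S &
    #|S| < #|[set B in P | odd #|B|]|].
Proof.
move=> sG evT nG.
pose bad := [pred H : {set {set T}} | (H \subset all_edges T) && ~~ pairable H].
have badG : bad G by rewrite /= sG; apply: contraNN nG; apply: pairable_perfect_matching.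
have [H /maxsetP[/andP[sH nH] maxH] GH] := maxset_exists badG.
have {}maxH e : e \in all_edges T -> e \notin H -> pairable (e |: H).
  move=> eE; apply: contraNT => ne; rewrite -(maxH (e |: H)) ?setU11 ?subsetUr //=.
  by rewrite ne andbT subUset sub1set eE sH.
pose S := [set s | [forall x, (x != s) ==> ([set s; x] \in H)]].
pose r x y := (x == y) || ([set x; y] \in H).
have rS : {in ~: S & &, equivalence_rel r}.
  move=> x y z; rewrite !in_setC => xS yS _; split; first by rewrite /r eqxx.
  have tr a b c : b \notin S -> r a b -> r b c -> r a c.
    move=> bS; rewrite /r => /orP[/eqP->//|ab] /orP[/eqP<-|bc]; first by rewrite ab orbT.
    have [//|nac] := eqVneq a c; apply: contraR bS => acH.
    rewrite inE; apply/forallP => d; apply/implyP => ndb.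
    exact: lovasz_step sH nH maxH ab bc nac acH ndb.
  have sym a b : r a b = r b a by rewrite /r eq_sym set2C.
  move=> rxy; apply/idP/idP; last exact: (tr x y z).
  by apply: (tr y x z) => //; rewrite sym.
have partP := equivalence_partitionP rS.
set P := equivalence_partition r (~: S) in partP.
have Pr B x y : B \in P -> x \in B -> y \in ~: S -> r x y = (y \in B).
  move=> BP xB yS; have xS : x \in ~: S.
    by rewrite -(cover_partition partP); apply/bigcupP; exists B.
  rewrite -(pblock_equivalence_partition rS) // -/P.
  have [_ tP _] := and3P partP; by rewrite (def_pblock tP BP xB).
exists S, P; split => //.
- move=> B x y BP xB /(subsetP GH) xyH; rewrite inE.
  have [_|yS] := boolP (y \in S); first by rewrite orbT.
  have := Pr B x y BP xB; rewrite inE => /(_ yS) <-.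
  by rewrite /r xyH !orbT.
- rewrite ltnNge; apply: contraNN nH => le; apply/pairableP.
  apply: (@clique_pairing H S P) => //.
  + move=> s x; rewrite inE => /forallP/(_ x)/implyP; exact.
  + move=> B x y BP xB yB nxy; have yS : y \in ~: S.
      by rewrite -(cover_partition partP); apply/bigcupP; exists B.
    by have := Pr B x y BP xB yS; rewrite yB /r (negPf nxy).
  + by rewrite cardsT.
  + rewrite setIT; apply: leq_trans le; apply: subset_leq_card.
    by apply/subsetP => B; rewrite !inE setIT.
Qed.

(** * From Tutte's condition to two kinds of obstruction *)

Definition cross (A B : {set T}) : {set {set T}} :=
  [set [set x; y] | x in A, y in B].

Lemma disjoint_crossP G A B :
  reflect (forall x y, x \in A -> y \in B -> [set x; y] \notin G)
          [disjoint G & cross A B].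
Proof.
rewrite disjoint_sym disjoints_subset.
apply: (iffP subsetP) => [h x y xA yB|h _ /imset2P[x y xA yB ->]].
  by have := h [set x; y]; rewrite inE; apply; apply: imset2_f.
by rewrite inE; apply: h.
Qed.

(** The family [Q] may omit some of the components left by the removal of [S];
    this lets large blocks be set aside. *)
Definition separated_blocks G S (Q : {set {set T}}) : Prop :=
  [/\ finset.trivIset Q, set0 \notin Q, [disjoint S & finset.cover Q] &
    forall B x y, B \in Q -> x \in B -> [set x; y] \in G -> y \in B :|: S].

Lemma leq_card_blocks (Q : {set {set T}}) :
  finset.trivIset Q -> set0 \notin Q -> #|Q| <= #|finset.cover Q|.
Proof.
move=> /eqP <- nQ; rewrite -sum1_card; apply: leq_sum => B BQ.
by rewrite card_gt0; apply: contraNneq nQ => <-.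
Qed.

Lemma separated_blocksS G S (Q Q' : {set {set T}}) :
  Q' \subset Q -> separated_blocks G S Q -> separated_blocks G S Q'.
Proof.
move=> sQ [tQ nQ dQ hQ]; split.
- exact: trivIsetS tQ.
- by apply: contraNN nQ; apply: (subsetP sQ).
- apply: disjointWr dQ; apply/bigcupsP => B BQ; apply: bigcup_sup.
  exact: (subsetP sQ).
- by move=> B x y /(subsetP sQ); apply: hQ.
Qed.

(** A vertex of [S] with at most one neighbour in the blocks is deleted from [S],
    together with the block of that neighbour: the other blocks remain separated
    and still outnumber the separator. *)
Lemma shrink_separator G S (Q : {set {set T}}) :
    separated_blocks G S Q -> #|S| < #|Q| ->
  exists S' Q', [/\ separated_blocks G S' Q', #|S'| < #|Q'|, Q' \subset Q &
    forall v, v \in S' -> exists x y, [/\ x \in finset.cover Q',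
      y \in finset.cover Q', x != y, [set v; x] \in G & [set v; y] \in G]].
Proof.
have [m] := ubnP #|S|; elim: m S Q => // m IH S Q; rewrite ltnS => leS sep ltSQ.
have [tQ nQ dQ hQ] := sep.
pose two v := [exists x in finset.cover Q, exists y in finset.cover Q,
   [&& x != y, [set v; x] \in G & [set v; y] \in G]].
have [/forallP all2|] := boolP [forall v in S, two v].
  exists S, Q; split=> // v vS; have := all2 v; rewrite vS /= => /existsP[x /andP[xQ]].
  by case/existsP => y /andP[yQ] /and3P[? ? ?]; exists x, y.
rewrite negb_forall => /existsP[v]; rewrite negb_imply => /andP[vS n2].
have [B BQ vB] : exists2 B, B \in Q &
    forall x, x \in finset.cover Q -> [set v; x] \in G -> x \in B.
  have [/existsP[x /andP[/bigcupP[B BQ xB] vx]]|nx] :=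
      boolP [exists x in finset.cover Q, [set v; x] \in G].
    exists B => // y yQ vy; apply: contraR n2 => yB; apply/existsP; exists x.
    rewrite (_ : x \in _); last by apply/bigcupP; exists B.
    apply/existsP; exists y; rewrite yQ vx vy !andbT /=.
    by apply: contraNneq yB => <-.
  have /card_gt0P[B BQ] : 0 < #|Q| by apply: leq_trans ltSQ.
  by exists B => // x xQ vx; case/negP: nx; apply/existsP; exists x; rewrite xQ.
have cQ := cardsD1 B Q; have cS := cardsD1 v S.
rewrite BQ vS !add1n in cQ cS.
have [|||S' [Q' [sep' lt' sQ' h']]] := IH (S :\ v) (Q :\ B).
- by rewrite -ltnS -cS.
- split.
  + by apply: trivIsetS tQ; apply: subD1set.
  + by apply: contraNN nQ; apply: (subsetP (subD1set _ _)).
  + apply: disjointWl (subD1set _ _) _; apply: disjointWr dQ.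
    apply/bigcupsP => C CQ; apply: bigcup_sup; exact: (subsetP (subD1set _ _) _ CQ).
  + move=> C x y; rewrite !inE => /andP[nCB CQ] xC xy.
    have := hQ C x y CQ xC xy; rewrite inE => /orP[->//|yS].
    rewrite yS andbT; apply/orP; right; apply: contraNneq nCB => yv.
    have xB : x \in B.
      by apply: vB; [apply/bigcupP; exists C|rewrite set2C -yv].
    apply: contraTT xB => nCB; have := trivIsetP tQ C B CQ BQ nCB.
    by move=> /disjointFr ->.
- by rewrite -ltnS -cS -cQ.
by exists S', Q'; split=> //; apply: subset_trans sQ' (subD1set _ _).
Qed.

(** If some block [B0] of the Tutte partition has at least a sixth of the
    vertices, the other blocks form [W], and parity leaves more than #|S| of
    them; [W] is either large, and separated from [B0], or small.  If all blocks
    are smaller than that, a minimal union of blocks reaching a sixth of the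
    vertices has less than a third of them, and the rest of the complement of
    [S], which has more than half of the vertices, is again large. *)
Lemma no_matching_obstruction G tau : G \subset all_edges T -> ~~ odd #|T| ->
    0 < #|T| -> 6 * tau <= #|T| -> (forall v, exists y, [set v; y] \in G) ->
    ~~ has_perfect_matching G ->
  (exists A B, [/\ [disjoint A & B], tau <= #|A|, #|T| <= 6 * #|B| &
     [disjoint G & cross A B]]) \/
  (exists S W, [/\ [disjoint S & W], #|S| < #|W|, #|W| < tau,
     [disjoint G & cross W (~: (S :|: W))] &
     (forall v, v \in S -> exists x y,
       [/\ x \in W, y \in W, x != y, [set v; x] \in G & [set v; y] \in G]) /\
     (S = set0 -> exists x y, [/\ x \in W, y \in W & [set x; y] \in G])]).
Proof.
move=> sG evT T0 tauT degG nG.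
have [S [P [partP PG odd_gt]]] := tutte sG evT nG.
have [/eqP covP tP nP] := and3P partP.
have sepP : separated_blocks G S P.
  by split=> //; rewrite covP disjoint_sym disjoints_subset.
have cST := cardsC S.
set k := #|[set B in P | odd #|B|]| in odd_gt; have kP : k <= #|P|.
  by apply: subset_leq_card; apply/subsetP => B; rewrite inE => /andP[].
have gt2 : #|S|.+1 < k.
  rewrite ltn_neqAle odd_gt andbT; apply: contraNneq evT => e.
  have := odd_blocks_card partP; rewrite -/k -e => /= oS.
  by rewrite -cST oddD oS addbN addbb.
have leP := leq_card_blocks tP nP; rewrite covP in leP.
have [/existsP[B0 /andP[B0P big0]]|noBig] := boolP [exists B0 in P, #|T| <= 6 * #|B0|].
  pose Q := P :\ B0; have sQ : Q \subset P by apply: subD1set.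
  have sepQ := separated_blocksS sQ sepP.
  have cP := cardsD1 B0 P; rewrite B0P add1n -/Q in cP.
  have [tauW|Wtau] := leqP tau #|finset.cover Q|.
    left; exists (finset.cover Q), B0.
    have dis x y : x \in finset.cover Q -> y \in B0 ->
        exists B, [/\ B \in P, x \in B, y \notin B & y \notin S].
      move=> /bigcupP[B]; rewrite !inE => /andP[nB BP] xB yB0; exists B; split=> //.
        by have := trivIsetP tP B B0 BP B0P nB => /disjointFl ->.
      by rewrite -in_setC -covP; apply/bigcupP; exists B0.
    split=> //.
      rewrite -setI_eq0; apply/eqP/setP => x; rewrite !inE; apply/negP => /andP[xQ xB].
      by have [B [_ xB' /negP]] := dis x x xQ xB.
    apply/disjoint_crossP => x y xQ yB0; have [B [BP xB yB yS]] := dis x y xQ yB0.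
    by apply/negP => /(PG B x y BP xB); rewrite inE (negPf yB) (negPf yS).
  right; have [|S' [Q' [sep' lt' sQ' two]]] := shrink_separator sepQ.
    by rewrite -ltnS -cP; apply: leq_trans gt2 kP.
  have [tQ' nQ' dQ' hQ'] := sep'.
  exists S', (finset.cover Q'); split=> //.
  - exact: leq_trans lt' (leq_card_blocks tQ' nQ').
  - apply: leq_ltn_trans Wtau; apply: subset_leq_card.
    by apply/bigcupsP => B BQ; apply: bigcup_sup; apply: (subsetP sQ').
  - apply/disjoint_crossP => x y /bigcupP[B BQ xB]; rewrite !inE negb_or.
    case/andP => yS yQ; apply/negP => /(hQ' B x y BQ xB).
    rewrite inE (negPf yS) orbF => yB; case/negP: yQ; apply/bigcupP; by exists B.
  - split=> // S0; have /card_gt0P[B BQ] : 0 < #|Q'| by apply: leq_trans lt'.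
    have /set0Pn[x xB] : B != set0 by apply: contraNneq nQ' => <-.
    have [y xy] := degG x; exists x, y; split=> //; apply/bigcupP; exists B => //.
    by have := hQ' B x y BQ xB xy; rewrite S0 setU0.
left; pose good := [pred Q : {set {set T}} | (Q \subset P) && (#|T| <= 6 * #|finset.cover Q|)].
have goodP : good P.
  rewrite /= subxx covP /=; move: kP gt2 leP cST; clear.
  by move: k #|S| #|~: S| #|P| #|T|; lia.
have [Q /minsetP[/andP[sQ bigQ] minQ] _] := minset_exists goodP.
exists (finset.cover Q), (~: S :\: finset.cover Q).
have [B BQ] : exists B, B \in Q.
  apply/set0Pn; apply: contraTneq bigQ => ->; rewrite /finset.cover big_set0 cards0.
  by rewrite -ltnNge.
have BP := subsetP sQ B BQ.
have smallB : 6 * #|B| < #|T|.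
  by rewrite ltnNge; apply: contraNN noBig => h; apply/existsP; exists B; rewrite BP.
have smallQ : 6 * #|finset.cover (Q :\ B)| < #|T|.
  rewrite ltnNge; apply/negP => h.
  have := minQ (Q :\ B); rewrite subD1set /= h andbT (subset_trans (subD1set _ _) sQ).
  by move=> /(_ isT isT) /setP/(_ B); rewrite !inE eqxx BQ.
have cQ : #|finset.cover Q| <= #|B| + #|finset.cover (Q :\ B)|.
  rewrite -[X in finset.cover X](setD1K BQ) /finset.cover bigcup_setU big_set1.
  by rewrite cardsU leq_subr.
have cD : #|~: S :\: finset.cover Q| = #|~: S| - #|finset.cover Q|.
  rewrite cardsD (setIidPr _) // -covP.
  by apply/bigcupsP => C CQ; apply: bigcup_sup; apply: (subsetP sQ).
split.
- by rewrite -setI_eq0; apply/eqP/setP => x; rewrite !inE; case: (x \in finset.cover Q); rewrite ?andbF.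
- by rewrite -(@leq_pmul2l 6) //; apply: leq_trans tauT bigQ.
- rewrite cD; move: smallB smallQ cQ cST kP gt2 leP; clear.
  move: k #|S| #|~: S| #|P| #|T| #|B| #|finset.cover Q| #|finset.cover (Q :\ B)|; lia.
- apply/disjoint_crossP => x y /bigcupP[C CQ xC]; rewrite !inE => /andP[yQ yS].
  apply/negP => /(PG C x y (subsetP sQ C CQ) xC); rewrite inE (negPf yS) orbF => yC.
  by case/negP: yQ; apply/bigcupP; exists C.
Qed.

(** * Isolated vertices *)

Lemma card_cross A B : [disjoint A & B] -> #|cross A B| = (#|A| * #|B|)%N.
Proof.
move=> dAB; rewrite /cross curry_imset2X card_in_imset ?cardsX //.
move=> [x y] [x' y'] /setXP[/= xA yB] /setXP[/= xA' yB'] /= e.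
have xx : x = x'.
  have := set21 x y; rewrite e => /set2P[//|xy].
  by have := disjointFr dAB xA; rewrite xy yB'.
congr pair => //; have := set22 x y; rewrite e => /set2P[yx|//].
by have := disjointFr dAB xA'; rewrite -yx yB.
Qed.

Lemma cross_edges A B : [disjoint A & B] -> cross A B \subset all_edges T.
Proof.
move=> dAB; apply/subsetP => _ /imset2P[x y xA yB ->]; rewrite inE cards2.
by case: (x =P y) => // xy; have := disjointFr dAB xA; rewrite xy yB.
Qed.

Definition star (v : T) : {set {set T}} := cross [set v] (~: [set v]).

Lemma star_edges v : star v \subset all_edges T.
Proof. by apply: cross_edges; rewrite -subsets_disjoint. Qed.

Lemma card_star v : #|star v| = #|T|.-1.
Proof.
by rewrite card_cross -?subsets_disjoint // cards1 mul1n cardsC1.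
Qed.

Lemma mem_star v e : (e \in star v) = (e \in all_edges T) && (v \in e).
Proof.
apply/idP/andP => [ev|[]].
  split; first exact: (subsetP (star_edges v)).
  by case/imset2P: ev => x y /set1P -> _ ->; rewrite set21.
rewrite inE => /cards2P[x [y [nxy ->]]] /set2P[] ->; last rewrite set2C;
by apply: imset2_f; rewrite !inE // eq_sym.
Qed.

Lemma card_star2 u v : u != v -> #|star u :|: star v| = (2 * #|T|.-1).-1.
Proof.
move=> nuv; rewrite cardsU !card_star.
rewrite (_ : star u :&: star v = [set [set u; v]]) ?cards1; first by lia.
apply/setP => e; rewrite !inE !mem_star; apply/andP/eqP => [|->].
  move=> [/andP[eE ue] /andP[_ ve]]; move: eE ue ve nuv.
  rewrite inE => /cards2P[x [y [_ ->]]] /set2P[]-> /set2P[]->; rewrite ?eqxx // => _.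
  exact: set2C.
by rewrite !inE !eqxx cards2 nuv orbT.
Qed.

Lemma degree_eq0 G v : G \subset all_edges T ->
  (degree G v == 0%N) = [disjoint star v & G].
Proof.
move=> sG; rewrite cards_eq0; apply/eqP/idP => [/setP h|].
  rewrite disjoint_subset; apply/subsetP => e; rewrite mem_star inE => /andP[_ ve].
  by have := h e; rewrite !inE ve andbT => ->.
move=> /disjoint_setI0/setP h; apply/setP => e; rewrite !inE.
have := h e; rewrite !inE mem_star.
case: (boolP (e \in G)) => //= eG; first by rewrite (subsetP sG) // andbT.
Qed.

Lemma min_degree_eq0 G : (0 < #|T|)%N -> G \subset all_edges T ->
  (min_degree G == 0%N) = [exists v, [disjoint star v & G]].
Proof.
move=> T0 sG; apply/idP/idP => [|/existsP[v]].
  apply: contraLR => /existsPn h; rewrite -lt0n /min_degree.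
  apply: (big_ind (fun m => 0 < m)%N) => // [x y x0 y0|v _].
    by rewrite leq_min x0.
  by rewrite lt0n degree_eq0.
rewrite -degree_eq0 // => /eqP dv; rewrite /min_degree.
have : v \in index_enum T by rewrite mem_index_enum.
elim: (index_enum T) => //= w s IH; rewrite inE big_cons => /orP[/eqP<-|/IH/eqP->].
  by rewrite dv min0n.
by rewrite minn0.
Qed.

Lemma min_degree_neighbour G : (0 < #|T|)%N -> G \subset all_edges T ->
  min_degree G != 0%N -> forall v, exists y, [set v; y] \in G.
Proof.
move=> T0 sG; rewrite min_degree_eq0 // => /existsPn h v.
have := h v; rewrite -setI_eq0 => /set0Pn[e]; rewrite inE => /andP[].
by move=> /imset2P[x y /set1P-> _ ->] ?; exists y.
Qed.

Lemma isolated_no_perfect_matching G : (0 < #|T|)%N -> G \subset all_edges T ->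
  min_degree G == 0%N -> ~~ has_perfect_matching G.
Proof.
move=> T0 sG; rewrite min_degree_eq0 // => /existsP[v].
apply: contraL => /existsP[M /and3P[MG _ /eqP cM]].
have /bigcupP[e eM ve] : v \in finset.cover M by rewrite cM inE.
rewrite -setI_eq0; apply/set0Pn; exists e.
by rewrite inE mem_star ve (subsetP sG) ?(subsetP MG).
Qed.

Lemma complete_perfect_matching : ~~ odd #|T| -> has_perfect_matching (all_edges T).
Proof.
move=> evT; apply: pairable_perfect_matching; apply/pairableP.
apply: (@clique_pairing _ [set: T] set0).
- rewrite setCT /finset.partition /finset.cover big_set0 eqxx inE andbT.
  by apply/trivIsetP => B C; rewrite inE.
- by move=> s x _ nxs; rewrite inE cards2 (eq_sym s) nxs.
- by move=> B x y; rewrite inE.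
- by rewrite cardsT.
- by rewrite (_ : [set B in _ | _] = set0) ?cards0 //; apply/setP => B; rewrite !inE.
Qed.

End Pairings.

Local Open Scope ring_scope.

(** * Elementary probability in G(n, p) *)

Section Gnp.
Variables (R : realType) (n : nat) (p : R).
Hypothesis p01 : 0 <= p <= 1.
Local Notation E := (all_edges 'I_n).
Implicit Types (A B G : {set {set 'I_n}}) (Q : {set {set 'I_n}} -> bool).

Let p0 : 0 <= p. Proof. by case/andP: p01. Qed.
Let q0 : 0 <= 1 - p. Proof. by rewrite subr_ge0; case/andP: p01. Qed.

Lemma gnp_mass_ge0 G : 0 <= gnp_mass p G.
Proof. by apply: prodr_ge0 => e _; case: ifP. Qed.

Lemma gnp_prE Q : gnp_pr p Q = \sum_(G in powerset E) gnp_mass p G * (Q G)%:R.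
Proof.
rewrite /gnp_pr big_mkcondr /=; apply: eq_bigr => G _.
by case: (Q G); rewrite ?mulr1 ?mulr0.
Qed.

(** Expanding the product over all edges of the sum of a weight for presence and
    a weight for absence, with the forbidden alternative weighted 0, gives both
    sides. *)
Lemma gnp_pr_contain_avoid A B : A \subset E -> B \subset E -> [disjoint A & B] ->
  gnp_pr p (fun G => (A \subset G) && [disjoint B & G]) =
  p ^+ #|A| * (1 - p) ^+ #|B|.
Proof.
move=> AE BE AB.
pose F (e : {set 'I_n}) := if (e \in E) && (e \notin B) then p else 0.
pose H (e : {set 'I_n}) :=
  if e \in E then if e \in A then 0 else 1 - p else 1.
transitivity (\prod_e (F e + H e)).
  rewrite bigA_distr /gnp_pr [LHS]big_mkcond; apply: eq_bigr => G _ /=.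
  rewrite powersetE; case: ifP => [/and3P[/subsetP GE /subsetP AG BG]|].
    rewrite /gnp_mass big_mkcond; apply: eq_bigr => e _; rewrite /F /H.
    case: (boolP (e \in G)) => eG.
      by rewrite GE // (disjointFl BG eG).
    by case: ifP => // _; rewrite ifF //; apply/negP => /AG; apply/negP.
  move=> /negP nGAB; symmetry.
  have [e e0] : exists e, (if e \in G then F e else H e) = 0.
    have [GE|/subsetPn[e eG eE]] := boolP (G \subset E); last first.
      by exists e; rewrite eG /F (negPf eE).
    have [AG|/subsetPn[e eA eG]] := boolP (A \subset G); last first.
      by exists e; rewrite (negPf eG) /H eA (subsetP AE).
    have : ~~ [disjoint B & G] by apply/negP => h; apply: nGAB; rewrite GE AG.
    rewrite -setI_eq0 => /set0Pn[e]; rewrite inE => /andP[eB eG].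
    by exists e; rewrite eG /F eB andbF.
  by rewrite (bigD1 e) //= e0 mul0r.
rewrite -!prodr_const [in RHS]big_mkcond [X in _ = _ * X]big_mkcond -big_split.
apply: eq_bigr => e _ /=; rewrite /F /H.
have [eA|eA] := boolP (e \in A).
  by rewrite (subsetP AE) // (disjointFr AB eA) /= addr0 mulr1.
have [eB|eB] := boolP (e \in B); rewrite mul1r.
  by rewrite (subsetP BE) // add0r.
by case: (e \in E); rewrite /= ?add0r // addrC subrK.
Qed.

Lemma gnp_pr_avoid B : B \subset E ->
  gnp_pr p (fun G => [disjoint B & G]) = (1 - p) ^+ #|B|.
Proof.
move=> BE; rewrite -[RHS]mul1r -[X in X * _](expr0 p) -[in X in X * _](cards0 {set 'I_n}).
rewrite -gnp_pr_contain_avoid ?sub0set //; last first.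
  by rewrite -setI_eq0 set0I.
by apply: eq_bigl => G; rewrite sub0set.
Qed.

Lemma gnp_pr_true : gnp_pr (n := n) p (fun=> true) = 1.
Proof.
rewrite -[RHS](expr0 (1 - p)) -[in RHS](cards0 {set 'I_n}).
rewrite -gnp_pr_avoid ?sub0set //; apply: eq_bigl => G.
by rewrite -setI_eq0 set0I eqxx.
Qed.

Lemma gnp_pr_ge0 Q : 0 <= gnp_pr p Q.
Proof. by apply: sumr_ge0 => G _; apply: gnp_mass_ge0. Qed.

Lemma gnp_pr_mono Q Q' : (forall G, G \subset E -> Q G -> Q' G) ->
  gnp_pr p Q <= gnp_pr p Q'.
Proof.
move=> h; rewrite !gnp_prE; apply: ler_sum => G; rewrite powersetE => GE.
apply: (ler_wpM2l (gnp_mass_ge0 G)); rewrite ler_nat.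
by have := h G GE; case: (Q G) => // ->.
Qed.

Lemma gnp_pr_split Q Q' : gnp_pr p Q =
  gnp_pr p (fun G => Q G && Q' G) + gnp_pr p (fun G => Q G && ~~ Q' G).
Proof.
rewrite !gnp_prE -big_split; apply: eq_bigr => G _ /=; rewrite -mulrDr.
by case: (Q G); case: (Q' G); rewrite ?addr0 ?add0r.
Qed.

Lemma gnp_pr_union (I : finType) (D : pred I) Q (Qi : I -> {set {set 'I_n}} -> bool) :
    (forall G, G \subset E -> Q G -> exists2 i, D i & Qi i G) ->
  gnp_pr p Q <= \sum_(i | D i) gnp_pr p (Qi i).
Proof.
move=> h; under eq_bigr do rewrite gnp_prE.
rewrite gnp_prE exchange_big /=; apply: ler_sum => G; rewrite powersetE => GE.
rewrite -mulr_sumr; apply: (ler_wpM2l (gnp_mass_ge0 G)).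
have := h G GE; case: (Q G) => [/(_ isT)[i Di QiG]|_].
  by rewrite (bigD1 i) //= QiG lerDl sumr_ge0.
by apply: sumr_ge0.
Qed.

(** For a counting variable X and any constant c, the indicator of X > 0 is at
    least 2 c X - c^2 X^2, because (c X - 1)^2 >= 0; take expectations and
    c = E X / E X^2. *)
Lemma gnp_pr_second_moment (I : finType) (Qi : I -> {set {set 'I_n}} -> bool) :
  (\sum_i gnp_pr p (Qi i)) ^+ 2 <=
  (\sum_i \sum_j gnp_pr p (fun G => Qi i G && Qi j G)) *
  gnp_pr p (fun G => [exists i, Qi i G]).
Proof.
set m1 := \sum_i gnp_pr p (Qi i); set m2 := \sum_i _; set P := gnp_pr _ _.
pose X G : R := \sum_i (Qi i G)%:R.
have m1E : m1 = \sum_(G in powerset E) gnp_mass p G * X G.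
  rewrite /m1; under eq_bigr do rewrite gnp_prE.
  rewrite exchange_big /=.
  by apply: eq_bigr => G _; rewrite mulr_sumr.
have m2E : m2 = \sum_(G in powerset E) gnp_mass p G * X G ^+ 2.
  rewrite /m2; under eq_bigr do under eq_bigr do rewrite gnp_prE.
  under eq_bigr do rewrite exchange_big /=.
  rewrite exchange_big /=; apply: eq_bigr => G _.
  rewrite expr2 /X big_distrlr /= mulr_sumr; apply: eq_bigr => i _.
  by rewrite mulr_sumr; apply: eq_bigr => j _; rewrite -natrM mulnb.
have key c : 2 * c * m1 - c ^+ 2 * m2 <= P.
  rewrite m1E m2E /P gnp_prE !mulr_sumr -sumrB; apply: ler_sum => G _.
  rewrite (_ : _ - _ = gnp_mass p G * (2 * c * X G - c ^+ 2 * X G ^+ 2)); last by ring.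
  apply: (ler_wpM2l (gnp_mass_ge0 G)); have [_|/existsPn nQ] := boolP [exists i, Qi i G].
    by have := sqr_ge0 (c * X G - 1); rewrite mulr1n; lra.
  by rewrite /X big1 ?expr0n /= ?mulr0 ?subr0 // => i _; rewrite (negPf (nQ i)).
have m2_0 : 0 <= m2.
  by rewrite m2E; apply: sumr_ge0 => G _; rewrite mulr_ge0 ?gnp_mass_ge0 ?sqr_ge0.
have [m20|m2n0] := eqVneq m2 0; last first.
  have := key (m1 / m2); rewrite -(ler_pM2l (_ : 0 < m2)) ?lt0r ?m2n0 //.
  by apply: le_trans; rewrite le_eqVlt; apply/orP; left; apply/eqP; field.
have [m10|m1n0] := eqVneq m1 0; first by rewrite m10 expr0n m20 mul0r.
have P1 : P <= 1 by rewrite -gnp_pr_true; apply: gnp_pr_mono.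
have := key (1 / m1); rewrite m20 mulr0 subr0.
by rewrite (_ : 2 * (1 / m1) * m1 = 2); [lra|field].
Qed.

End Gnp.

(** * Union bounds over the obstructions *)

Section Events.
Variables (R : realType) (n : nat) (p : R).
Hypothesis p01 : 0 <= p <= 1.
Local Notation E := (all_edges 'I_n).
Local Notation T := ('I_n).
Implicit Types (A B S W : {set T}) (G : {set {set T}}).

Let p0 : 0 <= p. Proof. by case/andP: p01. Qed.
Let q0 : 0 <= 1 - p. Proof. by rewrite subr_ge0; case/andP: p01. Qed.
Let q1 : 1 - p <= 1. Proof. by rewrite lerBlDr lerDl. Qed.

(** Two distinct vertices are both isolated when the 2 (n - 1) - 1 edges at
    either are absent, since the edge joining them is counted twice. *)
Lemma gnp_pr_isolated_sq : (1 < n)%N ->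
  (n%:R * (1 - p) ^+ n.-1) ^+ 2 <=
  n%:R * (1 - p) ^+ n.-1 * (1 + n.-1%:R * (1 - p) ^+ n.-2) *
    gnp_pr (n := n) p (fun G => min_degree G == 0%N).
Proof.
move=> n1; have cT : #|T| = n by rewrite card_ord.
have -> : gnp_pr (n := n) p (fun G => min_degree G == 0%N) =
          gnp_pr (n := n) p (fun G => [exists v, [disjoint star v & G]]).
  rewrite !gnp_prE; apply: eq_bigr => G; rewrite powersetE => GE.
  by rewrite min_degree_eq0 // cT ltnW.
have prs v : gnp_pr p (fun G => [disjoint star v & G]) = (1 - p) ^+ n.-1.
  by rewrite gnp_pr_avoid ?star_edges // card_star cT.
have prs2 u v : v != u ->
    gnp_pr p (fun G => [disjoint star u & G] && [disjoint star v & G]) =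
    (1 - p) ^+ n.-1 * (1 - p) ^+ n.-2.
  move=> nuv; transitivity (gnp_pr p (fun G => [disjoint star u :|: star v & G])).
    by apply: eq_bigl => G; rewrite -!setI_eq0 setIUl setU_eq0.
  rewrite gnp_pr_avoid ?subUset ?star_edges // card_star2 1?eq_sym // cT -exprD.
  by congr (_ ^+ _); case: (n) n1 => [|[|k]] //= _; lia.
have := gnp_pr_second_moment p01 (fun v : T => fun G => [disjoint star v & G]).
rewrite (eq_bigr _ (fun v _ => prs v)) sumr_const cT -[_ *+ n]mulr_natl.
rewrite (eq_bigr (fun=> (1 - p) ^+ n.-1 * (1 + n.-1%:R * (1 - p) ^+ n.-2))).
  by rewrite sumr_const cT -[(_ * (1 + _)) *+ n]mulr_natl mulrA.
move=> u _; rewrite (bigD1 u) //= (eq_bigr _ (fun v => @prs2 u v)) sumr_const.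
rewrite mulrDr mulr1; congr (_ + _).
  by rewrite -[RHS](prs u); apply: eq_bigl => G; rewrite andbb.
by rewrite cardC1 cT -mulr_natl; ring.
Qed.

Lemma gnp_pr_large_cut M :
  gnp_pr p (fun G => [exists AB : {set T} * {set T},
      [&& [disjoint AB.1 & AB.2], (M <= #|AB.1| * #|AB.2|)%N &
          [disjoint G & cross AB.1 AB.2]]]) <= 2 ^+ n * 2 ^+ n * (1 - p) ^+ M.
Proof.
pose D := [pred AB : {set T} * {set T} |
   [disjoint AB.1 & AB.2] && (M <= #|AB.1| * #|AB.2|)%N].
apply: (@le_trans _ _ (\sum_(AB | D AB) (1 - p) ^+ M)).
  apply: le_trans (gnp_pr_union p01 (D := D)
    (Qi := fun AB G => [disjoint cross AB.1 AB.2 & G]) _) _.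
    move=> G _ /existsP[AB /and3P[d c h]]; exists AB; rewrite /= ?d ?c //.
    by rewrite disjoint_sym.
  apply: ler_sum => -[A B] /andP[/= d c].
  by rewrite gnp_pr_avoid ?cross_edges // card_cross // ler_wiXn2l.
rewrite sumr_const -[_ *+ #|_|]mulr_natl ler_wpM2r ?exprn_ge0 // -natrX -natrM ler_nat.
apply: leq_trans (max_card _) _; rewrite card_prod.
by rewrite -cardsT -powersetT card_powerset cardsT card_ord.
Qed.

(** The small obstruction, as an event for a fixed pair of sets. *)
Definition trapping S W G : bool :=
  [&& [disjoint G & cross W (~: (S :|: W))],
     [forall v in S, exists xy : T * T, [&& xy.1 \in W, xy.2 \in W, xy.1 != xy.2,
        [set v; xy.1] \in G & [set v; xy.2] \in G]] &
     (S == set0) ==> [exists xy : T * T, [&& xy.1 \in W, xy.2 \in W,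
        xy.1 != xy.2 & [set xy.1; xy.2] \in G]]].

Lemma card_spokes S W (h : T -> T) : [disjoint S & W] ->
  (forall v, v \in S -> h v \in W) -> #|[set [set v; h v] | v in S]| = #|S|.
Proof.
move=> dSW hW; apply: card_in_imset => u v uS vS /= e.
have := set21 u (h u); rewrite e => /set2P[//|uh].
by have := disjointFr dSW uS; rewrite uh hW.
Qed.

(** Choose two neighbours in [W] for every vertex of [S], or the two ends of an
    edge inside [W] when [S] is empty.  The number of required edges is 2 #|S| or
    1, and the number of choices (#|W|^2)^#|S| or #|W|^2; both cases are covered by
    writing maxn #|S| 1 for the number of pairs chosen. *)
Lemma gnp_pr_trapping S W : [disjoint S & W] ->
  gnp_pr p (trapping S W) <=
  (#|W| ^ 2)%:R ^+ maxn #|S| 1 * p ^+ (#|S| + maxn #|S| 1) *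
  (1 - p) ^+ (#|W| * (n - #|S| - #|W|)).
Proof.
move=> dSW; set q := (1 - p) ^+ _.
have dWR : [disjoint W & ~: (S :|: W)] by rewrite -subsets_disjoint subsetUr.
have cR : #|cross W (~: (S :|: W))| = (#|W| * (n - #|S| - #|W|))%N.
  rewrite card_cross // (cardsCs (~: _)) setCK cardsU card_ord.
  by rewrite (eqP (_ : #|S :&: W| == 0%N)) ?subn0 ?subnDA // cards_eq0 setI_eq0.
have cross_ends x y : x \in S :|: W -> y \in S :|: W ->
    [set x; y] \notin cross W (~: (S :|: W)).
  move=> xSW ySW; apply/negP => /imset2P[a b aW bR e].
  have := set22 a b; rewrite -e => /set2P[] bE; move: bR; rewrite bE inE ?xSW ?ySW //.
have [S0|Sn0] := eqVneq S set0.
  rewrite (_ : #|S| = 0%N) ?max0n ?expr1 ?add0n ?expr1; last by rewrite S0 cards0.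
  apply: (@le_trans _ _ (\sum_(xy in setX W W) p * q)); last first.
    by rewrite sumr_const cardsX mulnn -[_ *+ _]mulr_natl mulrA.
  apply: le_trans (gnp_pr_union p01 (D := [pred xy in setX W W])
    (Qi := fun xy G => (xy.1 != xy.2) && (([set [set xy.1; xy.2]] \subset G) &&
       [disjoint cross W (~: (S :|: W)) & G])) _) _.
    move=> G _ /and3P[d _ /implyP/(_ (introT eqP S0))/existsP[[x y]]].
    move=> /= /and4P[xW yW nxy xyG]; exists (x, y); rewrite /= ?inE ?xW //=.
    by rewrite nxy sub1set xyG disjoint_sym.
  apply: ler_sum => -[x y]; rewrite !inE /= => /andP[xW yW].
  have [->|nxy] := eqVneq x y.
    by rewrite gnp_prE big1 ?mulr_ge0 ?exprn_ge0 // => G _; rewrite mulr0.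
  rewrite /= gnp_pr_contain_avoid ?cross_edges ?cards1 ?cR //.
  - by rewrite sub1set inE cards2 nxy.
  - by rewrite disjoints1 cross_ends // inE ?xW ?yW orbT.
have s0 : (0 < #|S|)%N by rewrite card_gt0.
rewrite (maxn_idPl s0); have /card_gt0P[v0 _] := s0.
pose spokes (i : T * T -> T) (h : {ffun T -> T * T}) := [set [set v; i (h v)] | v in S].
pose D := pffun_on (v0, v0) S (setX W W).
pose ok (h : {ffun T -> T * T}) := [forall v in S, (h v).1 != (h v).2].
apply: (@le_trans _ _ (\sum_(h in D) p ^+ (#|S| + #|S|) * q)); last first.
  rewrite sumr_const card_pffun_on cardsX mulnn -[_ *+ _]mulr_natl mulrA.
  by rewrite natrX.
apply: le_trans (gnp_pr_union p01 (D := D)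
  (Qi := fun h G => ok h && ((spokes fst h :|: spokes snd h \subset G) &&
     [disjoint cross W (~: (S :|: W)) & G])) _) _.
  move=> G _ /and3P[d /forallP nb _].
  pose P v := [pred xy : T * T | [&& xy.1 \in W, xy.2 \in W, xy.1 != xy.2,
        [set v; xy.1] \in G & [set v; xy.2] \in G]].
  pose h := [ffun v => if v \in S then odflt (v0, v0) [pick xy | P v xy] else (v0, v0)].
  have hP v : v \in S -> P v (h v).
    move=> vS; rewrite /h ffunE vS; case: pickP => //= nP.
    by have := nb v; rewrite vS /= => /existsP[xy]; rewrite -/(P v xy) nP.
  exists h.
    apply/pffun_onP; split.
      by apply/subsetP => v; rewrite inE /= /h ffunE; case: (v \in S) => //; rewrite eqxx.
    move=> _ /imageP[v vS ->]; have /and5P[a b _ _ _] := hP v vS.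
    by rewrite inE a b.
  rewrite disjoint_sym d andbT; apply/andP; split.
    by apply/forallP => v; apply/implyP => vS; have /and5P[] := hP v vS.
  rewrite subUset; apply/andP; split; apply/subsetP => _ /imsetP[v vS ->];
  by have /and5P[] := hP v vS.
apply: ler_sum => h /pffun_onP[_ hW].
have [okh|nok] := boolP (ok h); last first.
  by rewrite gnp_prE big1 ?mulr_ge0 ?exprn_ge0 // => G _; rewrite mulr0.
have {}hW v : v \in S -> (h v).1 \in W /\ (h v).2 \in W.
  by move=> vS; have := hW (h v) (image_f _ vS); rewrite inE => /andP.
have cF : #|spokes fst h :|: spokes snd h| = (#|S| + #|S|)%N.
  rewrite cardsU /spokes !(card_spokes dSW); try by move=> v /hW[].
  rewrite (_ : _ :&: _ = set0) ?cards0 ?subn0 //.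
  apply/setP => e; rewrite !inE; apply/negP => /andP[/imsetP[u uS ->] /imsetP[v vS e']].
  have [u1 _] := hW u uS; have [_ v2] := hW v vS.
  have := set21 u (h u).1; rewrite e' => /set2P[uv|uh]; last first.
    by have := disjointFr dSW uS; rewrite uh v2.
  have := set22 u (h u).1; rewrite e' => /set2P[hv|hh].
    by have := disjointFr dSW vS; rewrite -hv u1.
  by have := forallP okh v; rewrite vS -uv hh uv eqxx.
rewrite /= gnp_pr_contain_avoid ?cross_edges ?cF ?cR //.
- rewrite subUset; apply/andP; split; apply/subsetP => _ /imsetP[v vS ->];
  have [a b] := hW v vS; rewrite inE cards2;
  by case: (v =P _) => // vh; have := disjointFr dSW vS; rewrite vh ?a ?b.
- rewrite disjoint_subset; apply/subsetP => _ /setUP[] /imsetP[v vS ->];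
  have [a b] := hW v vS; rewrite inE; by apply: cross_ends; rewrite inE ?vS ?a ?b ?orbT.
Qed.

Lemma sum_by_card (h : nat -> R) :
  \sum_(S : {set T}) h #|S| = \sum_(k < n.+1) 'C(n, k)%:R * h k.
Proof.
rewrite (partition_big (fun S : {set T} => inord #|S| : 'I_n.+1) predT) //=.
apply: eq_bigr => k _.
have cS S : (#|S| < n.+1)%N by rewrite ltnS -[X in (_ <= X)%N](card_ord n) max_card.
rewrite (eq_bigr (fun=> h k)); last first.
  by move=> S /eqP <-; rewrite inordK.
rewrite sumr_const -[_ *+ _]mulr_natl; congr (_%:R * _).
rewrite -[X in 'C(X, _)](card_ord n) -card_draws; apply: eq_card => S.
rewrite [in RHS]inE unfold_in /=; by apply/eqP/eqP; rewrite inordK.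
Qed.

(** A trapping pair has 1 < #|W|: this holds because #|S| < #|W| if [S] is
    nonempty, and because [W] contains an edge otherwise.  The term
    s = 0, t = 1 has to be excluded: it is p mu, which is not o(mu) when p is
    bounded away from 0. *)
Lemma gnp_pr_trapped tau :
  gnp_pr p (fun G => [exists SW : {set T} * {set T},
      [&& [disjoint SW.1 & SW.2], (#|SW.1| < #|SW.2|)%N, (#|SW.2| < tau)%N &
          trapping SW.1 SW.2 G]]) <=
  \sum_(s < n.+1) \sum_(t < n.+1 | (s < t < tau)%N && (1 < t)%N)
    'C(n, s)%:R * 'C(n, t)%:R *
    ((t ^ 2)%:R ^+ maxn s 1 * p ^+ (s + maxn s 1) * (1 - p) ^+ (t * (n - s - t))).
Proof.
pose f s t : R := (t ^ 2)%:R ^+ maxn s 1 * p ^+ (s + maxn s 1) * (1 - p) ^+ (t * (n - s - t)).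
pose c s t := (s < t < tau)%N && (1 < t)%N.
have f0 s t : 0 <= f s t by rewrite /f !mulr_ge0 ?exprn_ge0.
apply: (@le_trans _ _ (\sum_(S : {set T}) \sum_(W : {set T}) if c #|S| #|W| then f #|S| #|W| else 0)).
  rewrite pair_big /=.
  apply: le_trans (gnp_pr_union p01 (D := [pred SW : {set T} * {set T} |
     [disjoint SW.1 & SW.2] && c #|SW.1| #|SW.2|])
    (Qi := fun SW G => trapping SW.1 SW.2 G) _) _.
    move=> G GE /existsP[[S W] /and4P[/= d lt ltau tr]]; exists (S, W) => //.
    rewrite /= d /c lt ltau /=; have [S0|] := eqVneq S set0.
      move: tr; rewrite /trapping S0 eqxx => /and3P[_ _ /existsP[[x y] /and4P[/= xW yW nxy _]]].
      by apply/card_gt1P; exists x, y.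
    by rewrite -card_gt0 => /leq_ltn_trans; apply.
  rewrite big_mkcond /=; apply: ler_sum => -[S W] _ /=.
  case: (boolP [disjoint S & W]) => d /=; last by case: ifP.
  by case: ifP => // _; apply: gnp_pr_trapping.
rewrite (eq_bigr (fun S : {set T} => \sum_(t < n.+1) 'C(n, t)%:R * if c #|S| t then f #|S| t else 0)); last first.
  by move=> S _; rewrite (sum_by_card (fun t => if c #|S| t then f #|S| t else 0)).
rewrite (sum_by_card (fun s => \sum_(t < n.+1) 'C(n, t)%:R * if c s t then f s t else 0)).
apply: ler_sum => s _; rewrite mulr_sumr [X in _ <= X]big_mkcond /=.
apply: ler_sum => t _; rewrite -/(c s t) -/(f s t).
by case: ifP => _; rewrite ?mulr0 // mulrA.
Qed.

(** The cutoff [tau] between large and small obstructions is left free; it will be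
    of order n / log n. *)
Lemma gnp_pr_no_matching tau M : ~~ odd n -> (0 < n)%N ->
    (6 * tau <= n)%N -> (6 * M <= tau * n)%N ->
  gnp_pr (n := n) p (fun G => ~~ has_perfect_matching G && (min_degree G != 0%N)) <=
  2 ^+ n * 2 ^+ n * (1 - p) ^+ M +
  \sum_(s < n.+1) \sum_(t < n.+1 | (s < t < tau)%N && (1 < t)%N)
    'C(n, s)%:R * 'C(n, t)%:R *
    ((t ^ 2)%:R ^+ maxn s 1 * p ^+ (s + maxn s 1) * (1 - p) ^+ (t * (n - s - t))).
Proof.
move=> evn n0 tau6 M6; set Q := fun G : {set {set T}} => _ && _.
pose L G := [exists AB : {set T} * {set T},
      [&& [disjoint AB.1 & AB.2], (M <= #|AB.1| * #|AB.2|)%N &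
          [disjoint G & cross AB.1 AB.2]]].
rewrite (gnp_pr_split p Q L); apply: lerD.
  apply: le_trans (gnp_pr_large_cut M); apply: gnp_pr_mono => // G _ /andP[_].
  by apply.
apply: le_trans (gnp_pr_trapped tau); apply: gnp_pr_mono => // G GE /andP[/andP[nM dG] nL].
have cT := card_ord n.
have := @no_matching_obstruction T G tau GE; rewrite cT.
case/(_ evn n0 tau6 (min_degree_neighbour _ GE dG) nM); first by rewrite cT.
  case=> A [B [dAB lA lB h]]; case/negP: nL; apply/existsP; exists (A, B).
  rewrite /= dAB h andbT -(@leq_pmul2l 6) //; apply: leq_trans M6 _.
  by rewrite mulnCA leq_mul.
case=> S [W [dSW lt ltau h [two inner]]]; apply/existsP; exists (S, W).
rewrite /= dSW lt ltau /trapping h /=; apply/andP; split.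
  apply/forallP => v; apply/implyP => /two[x [y [xW yW nxy vx vy]]].
  by apply/existsP; exists (x, y); rewrite /= xW yW nxy vx vy.
apply/implyP => /eqP /inner[x [y [xW yW xy]]]; apply/existsP; exists (x, y).
by rewrite /= xW yW xy (edge_neq GE xy).
Qed.

End Events.

(** * Estimates *)

(** Below, lam stands for log n and enters through expR lam = n%:R. *)

Section Estimates.
Variable R : realType.
Implicit Types (p q x lam kap C : R) (n s t m : nat).

(** A first success at trial m + 1 is the least likely of m + 1 disjoint events. *)
Lemma mul_one_sub_exp_le p m : 0 <= p <= 1 -> p * (1 - p) ^+ m <= m.+1%:R^-1.
Proof.
move=> /andP[p0 p1]; have q0 : 0 <= 1 - p by lra.
suff h : m.+1%:R * (p * (1 - p) ^+ m) + (1 - p) ^+ m.+1 <= 1.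
  rewrite -[_^-1]mul1r ler_pdivlMr ?ltr0n // mulrC; apply: le_trans h.
  by rewrite lerDl exprn_ge0.
elim: m => [|m IH]; first by rewrite expr0 expr1 mul1r mulr1; lra.
have e0 : 0 <= (1 - p) ^+ m.+1 <= 1 by rewrite exprn_ge0 // exprn_ile1; lra.
have := ler_wpM2l q0 IH; move: e0; rewrite -[m.+2%:R]natr1 (exprS _ m.+1) exprS.
nra.
Qed.

Lemma exp_le_expR q a L E : 0 <= q -> (0 < a)%N -> q ^+ a <= expR (- L) ->
  q ^+ E <= expR (- (L / a%:R * E%:R)).
Proof.
move=> q0 a0 qa; have ane : a%:R != 0 :> R by rewrite pnatr_eq0 -lt0n.
have qle : q <= expR (- (L / a%:R)).
  rewrite -(@ler_pXn2r _ a) ?nnegrE ?expR_ge0 // -expRM_natl.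
  by rewrite mulrN mulrCA divff // mulr1.
rewrite -mulNr mulrC expRM_natl; apply: lerXn2r => //; by rewrite nnegrE ?expR_ge0.
Qed.

Lemma pow_fact_le_expR x m : 0 <= x -> x ^+ m / m`!%:R <= expR x.
Proof.
move=> x0; case: m => [|m].
  by rewrite expr0 fact0 divr1 -[X in X <= _]addr0; apply: le_trans (expR_ge1Dx x); lra.
by apply: le_trans (expR_ge1Dxn m x0); rewrite lerDr.
Qed.

Lemma bin_le_expR n m lam : expR lam = n%:R ->
  'C(n, m)%:R <= expR (m%:R * lam) / m`!%:R.
Proof.
move=> en; rewrite ler_pdivlMr ?ltr0n ?fact_gt0 // expRM_natl en -natrM -natrX ler_nat.
rewrite bin_ffact; elim: m => [|m IH]; first by rewrite ffactn0.
by rewrite ffactnSr expnSr leq_mul // leq_subr.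
Qed.

Lemma two_le_expR1 : 2 <= expR (1 : R).
Proof. by apply: le_trans (expR_ge1Dx 1); lra. Qed.

Lemma natpow_le_expR m : (2 ^ m)%:R <= expR (m%:R : R).
Proof.
rewrite -[X in expR X]mulr1 expRM_natl natrX lerXn2r ?nnegrE ?expR_ge0 //.
exact: two_le_expR1.
Qed.

(** With s' = maxn s 1, all factors become exponentials and the exponents are
    compared.  Each of the s + s' factors p is combined with q^(n/8) and becomes
    at most e^3 / n.  One factor q^(n-1) is kept for mu, and the remaining power
    of q is at most n^-(t-1) n^(s'/2) e^(O(t)): the second factor is the price of
    the trade, and the loss from s + t in the exponent is e^(O(t)) because
    t log n = O(n).  The powers of n then combine to n n^(-s'/2).  As
    t! >= s'! (t - s')! and s'! = s!, the factors t^(2 s') / (s! t!) are at most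
    e^(2 t) / (t - s')!, and that last factorial absorbs any c^(t - s'), while
    n^(-s'/2) absorbs c^s'. *)
Lemma trapped_term_le n p lam kap C s t :
    0 <= p <= 1 -> expR lam = n%:R -> n%:R * (1 - p) ^+ n.-1 <= expR kap ->
    0 <= kap -> 0 <= C -> (s < t)%N -> (1 < t)%N -> (8 * t <= n)%N ->
    t%:R * lam <= C * n%:R -> kap + 4 * C + 10 <= lam / 2 ->
  'C(n, s)%:R * 'C(n, t)%:R *
    ((t ^ 2)%:R ^+ maxn s 1 * p ^+ (s + maxn s 1) * (1 - p) ^+ (t * (n - s - t))) <=
  n%:R * (1 - p) ^+ n.-1 * (1 / 4) ^+ t *
    expR (kap + 4 * C + 10 - lam / 2 + expR (kap + 4 * C + 10)).
Proof.
move=> p01 en muK k0 C0 st t1 tn tC; set a := kap + _ + _ => aL.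
have [sst stn sst2 n2] : [/\ (s + maxn s 1 <= 2 * t.-1)%N, (s + t <= n)%N,
    (s + maxn s 1 <= 2 * t)%N & (2 <= n)%N] 
    by move: st t1 tn; clear=> st t1 tn; split; lia.
have n0 : (0 < n)%N by apply: ltnW.
have n10 : (0 < n.-1)%N by case: (n) n2 => [|[]].
have /andP[p0 p1] := p01; have q0 : 0 <= 1 - p by lra.
set q := 1 - p in q0 muK *.
set s' := maxn s 1 in sst sst2 *; have s's : s'`! = s`! by rewrite /s'; case: (s) => [|[|k]].
have s't : (s' <= t)%N by rewrite /s' geq_max ltnW // ltnW.
have s'1 : (1 <= s')%N by rewrite /s' leq_maxr.
have ss' : (s <= s')%N by rewrite /s' leq_maxl.
set j := (t - s')%N; pose m := (n %/ 8)%N.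
have nR0 : 0 < n%:R :> R by rewrite ltr0n.
have [E EE] : exists E, (t * (n - s - t) = n.-1 + m * (s + s') + E)%N.
  exists (t * (n - s - t) - (n.-1 + m * (s + s')))%N; rewrite subnKC //.
  have m8 : (8 * m <= n)%N by rewrite /m mulnC leq_trunc_div.
  have : (m * (s + s') <= m * (2 * t.-1))%N by rewrite leq_mul.
  have : (t * (n - 2 * t) <= t * (n - s - t))%N by rewrite leq_mul //; move: st; clear; lia.
  case: (t) t1 tn => // k _; clear; nia.
have tR : s%:R + 1 <= t%:R :> R by rewrite natr1 ler_nat.
have t2R : 2 <= t%:R :> R by rewrite ler_nat.
have n2R : 2 <= n%:R :> R by rewrite ler_nat.
have ss'R : s%:R <= s'%:R :> R by rewrite ler_nat.
have s'1R : 1 <= s'%:R :> R by rewrite ler1n.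
have n1R : n.-1%:R = n%:R - 1 :> R by rewrite -[in RHS](prednK n0) -natr1 addrK.
have Ereal : (t%:R - 1) * (n%:R - 1) - 2 * t%:R ^+ 2 - s'%:R * n%:R / 4 <= E%:R :> R.
  have m8 : 8 * m%:R <= n%:R :> R by rewrite -natrM ler_nat /m mulnC leq_trunc_div.
  have := congr1 (fun k => k%:R : R) EE; rewrite /= !natrD !natrM natrD.
  rewrite -subnDA natrB ?natrD ?n1R //.
  have : m%:R * (s%:R + s'%:R) <= n%:R * s'%:R / 4 :> R.
    apply: (@le_trans _ _ (m%:R * (2 * s'%:R))); first by rewrite ler_wpM2l //; lra.
    by have := ler_wpM2r (ler0n R s') m8; lra.
  have : t%:R * s%:R <= t%:R * (t%:R - 1) :> R by rewrite ler_wpM2l //; lra.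
  by lra.
have lam0 : 0 <= lam by rewrite /a in aL; lra.
have aE : a = kap + 4 * C + 10 by [].
clearbody a.
(* q ^ (n - 1) <= e ^ (kap - lam) turns the spare exponent E into a power of 1/n *)
have qE : q ^+ E <= expR (- (t%:R - 1) * (lam - kap) + 4 * C * t%:R + s'%:R * lam / 2).
  have qn : q ^+ n.-1 <= expR (- (lam - kap)).
    by rewrite opprB expRB en ler_pdivlMr // mulrC.
  apply: le_trans (exp_le_expR E q0 n10 qn) _.
  rewrite ler_expR n1R; set b := (lam - kap) / _.
  have n10R : 0 < n%:R - 1 :> R by lra.
  have b0 : 0 <= b by rewrite divr_ge0 //; lra.
  have bE : b * (n%:R - 1) = lam - kap by rewrite /b divfK // gt_eqF.
  have bn : b * n%:R <= 2 * lam.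
    have : b * 1 <= b * (n%:R - 1) by rewrite ler_wpM2l //; lra.
    by lra.
  have bt : b * t%:R ^+ 2 <= 2 * C * t%:R.
    rewrite -(ler_pM2r nR0).
    have h1 : (b * n%:R) * t%:R ^+ 2 <= 2 * lam * t%:R ^+ 2 by rewrite ler_wpM2r // sqr_ge0.
    have h2 : (t%:R * lam) * t%:R <= C * n%:R * t%:R by rewrite ler_wpM2r.
    by lra.
  have bs : (b * n%:R) * s'%:R <= 2 * lam * s'%:R by rewrite ler_wpM2r.
  have := ler_wpM2l b0 Ereal; have := congr1 (fun x => (t%:R - 1) * x) bE => /=.
  by lra.
have pq : p ^+ (s + s') * q ^+ (m * (s + s')) <= expR ((3 - lam) * (s%:R + s'%:R)).
  rewrite exprM -exprMn -natrD [X in expR X]mulrC expRM_natl.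
  apply: lerXn2r; rewrite ?nnegrE ?expR_ge0 ?mulr_ge0 ?exprn_ge0 //.
  apply: le_trans (mul_one_sub_exp_le m p01) _.
  rewrite expRB en -[_^-1]mul1r ler_pdivrMr ?ltr0n // mulrAC ler_pdivlMr // mul1r.
  apply: le_trans (_ : 8 * m.+1%:R <= _).
    by rewrite -natrM ler_nat /m mulnC ltnW // ltn_ceil.
  by rewrite ler_wpM2r //; apply: natpow_le_expR 3.
(* the factorial of t - s' absorbs (e ^ a) ^ (t - s') *)
have jfact : (j`!%:R)^-1 <= expR (expR a - a * j%:R).
  rewrite expRB -[X in X <= _]mul1r ler_pdivlMr ?expR_gt0 // mul1r expRM_natr mulrC.
  exact: pow_fact_le_expR (expR_ge0 a).
have binst : 'C(n, s)%:R * 'C(n, t)%:R * (t ^ 2)%:R ^+ s' <=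
    expR (s%:R * lam + t%:R * lam + 2 * t%:R + expR a - a * j%:R).
  have tf : (t`!%:R)^-1 <= (s'`!%:R)^-1 * (j`!%:R)^-1 :> R.
    rewrite -invfM lef_pV2 ?posrE ?mulr_gt0 ?ltr0n ?fact_gt0 //.
    by rewrite -natrM ler_nat -(bin_fact s't) leq_pmull // bin_gt0.
  apply: (@le_trans _ _ (expR (s%:R * lam) / s'`!%:R *
      (expR (t%:R * lam) * ((s'`!%:R)^-1 * (j`!%:R)^-1)) * (t%:R ^+ s' * t%:R ^+ s'))).
    rewrite natrX -exprM mulnC exprM exprS expr1.
    apply: ler_wpM2r; first by rewrite mulr_ge0 ?exprn_ge0.
    apply: ler_pM => //; first by rewrite s's; apply: bin_le_expR.
    apply: le_trans (bin_le_expR t en) _.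
    by apply: ler_wpM2l tf; rewrite expR_ge0.
  rewrite (_ : _ * _ = expR (s%:R * lam) * expR (t%:R * lam) *
     ((t%:R ^+ s' / s'`!%:R) * (t%:R ^+ s' / s'`!%:R)) * (j`!%:R)^-1); last by ring.
  have -> : s%:R * lam + t%:R * lam + 2 * t%:R + expR a - a * j%:R =
     s%:R * lam + t%:R * lam + (t%:R + t%:R) + (expR a - a * j%:R) by ring.
  have j0 : 0 <= (j`!%:R)^-1 :> R by rewrite invr_ge0.
  have pow_t : t%:R ^+ s' / s'`!%:R <= expR t%:R :> R by apply: pow_fact_le_expR.
  have pow_t0 : 0 <= t%:R ^+ s' / s'`!%:R :> R by rewrite divr_ge0 ?exprn_ge0.
  rewrite !expRD -[expR (expR a) * _]expRD.
  apply: le_trans (ler_wpM2r j0 (ler_wpM2l _ (ler_pM pow_t0 pow_t0 pow_t pow_t))) _.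
    by rewrite mulr_ge0 ?expR_ge0.
  by apply: ler_wpM2l jfact; rewrite !mulr_ge0 ?expR_ge0.
have quarter : expR (- (2 * t%:R)) <= (1 / 4) ^+ t :> R.
  rewrite mulrC -mulrN expRM_natl; apply: lerXn2r; rewrite ?nnegrE ?expR_ge0 //.
  rewrite expRN mul1r lef_pV2 ?posrE ?expR_gt0 //.
  exact: natpow_le_expR 2.
rewrite EE [q ^+ _]exprD [q ^+ (_ + _)]exprD.
apply: (@le_trans _ _ (expR (s%:R * lam + t%:R * lam + 2 * t%:R + expR a - a * j%:R) *
   (q ^+ n.-1 * (expR ((3 - lam) * (s%:R + s'%:R)) *
    expR (- (t%:R - 1) * (lam - kap) + 4 * C * t%:R + s'%:R * lam / 2))))).
  rewrite [X in X <= _](_ : _ = 'C(n, s)%:R * 'C(n, t)%:R * (t ^ 2)%:R ^+ s' *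
    (q ^+ n.-1 * (p ^+ (s + s') * q ^+ (m * (s + s')) * q ^+ E))); last first.
    by rewrite -!mulrA; congr (_ * (_ * (_ * _))); rewrite mulrCA.
  apply: ler_pM => //; rewrite ?mulr_ge0 ?exprn_ge0 //.
  apply: ler_wpM2l; first exact: exprn_ge0.
  by apply: ler_pM; rewrite // ?mulr_ge0 ?exprn_ge0.
apply: (@le_trans _ _ (n%:R * q ^+ n.-1 * expR (- (2 * t%:R)) *
   expR (a - lam / 2 + expR a))); last first.
  by apply: ler_wpM2r; rewrite ?expR_ge0 //; apply: ler_wpM2l; rewrite // mulr_ge0 ?exprn_ge0.
rewrite -en -expRD.
rewrite (_ : expR lam * _ * _ * _ = q ^+ n.-1 * (expR lam * expR (- (2 * t%:R)) *
   expR (a - lam / 2 + expR a))); last by ring.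
rewrite mulrCA; apply: ler_wpM2l; first exact: exprn_ge0.
rewrite -!expRD ler_expR /j natrB // aE.
have : (s'%:R - 1) * (lam / 2 - a) >= 0 :> R by rewrite mulr_ge0 //; lra.
have : s%:R + s'%:R <= 2 * t%:R :> R by rewrite -natrD -natrM ler_nat.
rewrite aE; lra.
Qed.

(** The condition on [tau] makes the exponent [M] at least of order n^2 / log n, so
    that q^M is at most e^(-c n), with c large enough (whence 48) to beat the 4^n
    choices and leave a factor q^(n-1). *)
Lemma large_term_le n q lam kap tau M :
    0 <= q <= 1 -> expR lam = n%:R -> n%:R * q ^+ n.-1 <= expR kap ->
    0 <= kap -> kap <= lam / 2 -> (1 < n)%N ->
    48 * n%:R <= tau%:R * lam -> (tau * n < 6 * M.+1)%N ->
  2 ^+ n * 2 ^+ n * q ^+ M <= q ^+ n.-1.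
Proof.
move=> /andP[q0 q1] en muK k0 kL n1 tauL tauM.
have nR0 : 0 < n%:R :> R by rewrite ltr0n ltnW.
have lamn : lam <= n%:R by rewrite -en; have := expR_ge1Dx lam; lra.
have n10 : (0 < n.-1)%N by case: (n) n1 => [|[]].
have n1R : n.-1%:R = n%:R - 1 :> R by rewrite -[in RHS](prednK (ltnW n1)) -natr1 addrK.
have n2R : 2 <= n%:R :> R by rewrite ler_nat.
have tau48 : 48 <= tau%:R :> R.
  have : 48 * n%:R <= tau%:R * n%:R :> R by apply: le_trans tauL _; rewrite ler_wpM2l.
  by rewrite ler_pM2r.
have MR : tau%:R * n%:R <= 6 * (M%:R + 1) :> R by rewrite natr1 -!natrM ler_nat ltnW.
have nM : (n <= M)%N.
  rewrite -ltnS -(ltr_nat R) -natr1.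
  have : 48 * n%:R <= tau%:R * n%:R :> R by rewrite ler_wpM2r.
  by lra.
have nM1 : (n.-1 <= M)%N by apply: leq_trans nM; apply: leq_pred.
rewrite -(subnKC nM1) exprD mulrCA -[X in _ <= X]mulr1.
apply: ler_wpM2l; first exact: exprn_ge0.
have qn : q ^+ n.-1 <= expR (- (lam - kap)).
  by rewrite opprB expRB en ler_pdivlMr // mulrC.
apply: le_trans (ler_wpM2l _ (exp_le_expR (M - n.-1) q0 n10 qn)) _.
  by rewrite mulr_ge0 ?exprn_ge0.
apply: (@le_trans _ _ (expR n%:R * expR n%:R *
    expR (- ((lam - kap) / n.-1%:R * (M - n.-1)%:R)))).
  apply: ler_wpM2r; first exact: expR_ge0.
  by rewrite -natrX; apply: ler_pM; rewrite ?natpow_le_expR.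
rewrite -!expRD expR_le1 natrB // n1R; set b := (lam - kap) / _.
have n10R : 0 < n%:R - 1 :> R by lra.
have b0 : 0 <= b by rewrite divr_ge0 //; lra.
have bE : b * (n%:R - 1) = lam - kap by rewrite /b divfK // gt_eqF.
have h1 : b * ((n%:R - 1) * (tau%:R / 6 - 1)) <= b * (M%:R - (n%:R - 1)).
  apply: ler_wpM2l => //.
  have : (n%:R - 1) * (tau%:R / 6 - 1) <= n%:R * (tau%:R / 6 - 1) :> R.
    by rewrite ler_wpM2r; lra.
  by lra.
have h2 : lam / 2 * (tau%:R / 6 - 1) <= (lam - kap) * (tau%:R / 6 - 1).
  by rewrite ler_wpM2r; lra.
move: h1; rewrite mulrA bE; lra.
Qed.

Lemma geometric_half_le2 m : \sum_(i < m) (1 / 2 : R) ^+ i <= 2.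
Proof.
suff -> : \sum_(i < m) (1 / 2 : R) ^+ i = 2 - 2 * (1 / 2) ^+ m.
  by rewrite lerBlDr lerDl mulr_ge0 // exprn_ge0 // divr_ge0.
elim: m => [|m IH]; first by rewrite big_ord0 expr0; lra.
by rewrite big_ord_recr /= IH exprS; lra.
Qed.

(** With tau about 48 n / lam the constant of [trapped_term_le] is C = 48, and
    202 = 4 * 48 + 10.  The factor 4^-t is split as 2^-s 2^-t, using s < t, to sum
    over both sizes. *)
Lemma gnp_pr_no_matching_le n p lam kap :
    ~~ odd n -> 0 <= p <= 1 -> expR lam = n%:R ->
    n%:R * (1 - p) ^+ n.-1 <= expR kap -> 0 <= kap -> kap + 202 <= lam / 2 ->
    576 <= lam ->
  gnp_pr (n := n) p (fun G => ~~ has_perfect_matching G && (min_degree G != 0%N)) <=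
  (1 - p) ^+ n.-1 +
  n%:R * (1 - p) ^+ n.-1 * (4 * expR (kap + 202 - lam / 2 + expR (kap + 202))).
Proof.
move=> evn p01 en muK k0 aL lam576.
have lamn : lam <= n%:R by rewrite -en; have := expR_ge1Dx lam; lra.
have n1 : (1 < n)%N by rewrite -(ltr_nat R); lra.
have lam0 : 0 < lam by lra.
have q01 : 0 <= 1 - p <= 1 by case/andP: p01 => *; apply/andP; split; lra.
have q0 : 0 <= 1 - p by case/andP: q01.
(* 576 = 12 * 48 makes 48 n / lam at most n / 12, whence 6 tau <= n *)
pose tau := (Num.truncn (48 * n%:R / lam)).+1.
have x0 : 0 <= 48 * n%:R / lam by rewrite divr_ge0 ?mulr_ge0 // ltW.
have xn : 48 * n%:R / lam <= n%:R / 12.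
  rewrite ler_pdivrMr //; have : n%:R * 576 <= n%:R * lam by rewrite ler_wpM2l.
  by lra.
have tau_le t : (t < tau)%N -> t%:R <= 48 * n%:R / lam.
  by rewrite /tau ltnS (truncn_ge_nat t x0).
have tau6R : 6 * tau%:R <= n%:R :> R.
  have := tau_le (Num.truncn (48 * n%:R / lam)) (ltnSn _).
  by rewrite /tau -natr1; lra.
have tau6 : (6 * tau <= n)%N by rewrite -(ler_nat R) natrM.
pose M := (tau * n %/ 6)%N.
have M6 : (6 * M <= tau * n)%N by rewrite /M mulnC leq_trunc_div.
have M6' : (tau * n < 6 * M.+1)%N by rewrite /M [(6 * _)%N]mulnC ltn_ceil.
apply: le_trans (gnp_pr_no_matching p01 evn (ltnW n1) tau6 M6) _.
set a := kap + 202 in aL *; set X := expR _.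
have aE : a = kap + 4 * 48 + 10 by rewrite /a; lra.
apply: lerD.
  apply: (large_term_le q01 en muK) n1 _ M6' => //; first by lra.
  by rewrite -ler_pdivrMr // ltW // truncnS_gt.
set mu := n%:R * _.
have mu0 : 0 <= mu by rewrite mulr_ge0 ?exprn_ge0.
have X0 : 0 <= X by apply: expR_ge0.
have h0 : 0 <= 1 / 2 :> R by rewrite divr_ge0.
apply: (@le_trans _ _ (\sum_(s < n.+1) \sum_(t < n.+1)
    mu * X * ((1 / 2) ^+ s * (1 / 2) ^+ t))); last first.
  rewrite (eq_bigr (fun s : 'I_n.+1 =>
    mu * X * ((1 / 2) ^+ s * \sum_(t < n.+1) (1 / 2) ^+ t))); last first.
    by move=> s _; rewrite -!mulr_sumr.
  rewrite -mulr_sumr -mulr_suml (_ : mu * (4 * X) = mu * X * (2 * 2)); last by lra.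
  apply: ler_wpM2l; first exact: mulr_ge0.
  by apply: ler_pM; rewrite ?geometric_half_le2 ?sumr_ge0 // => i _; rewrite exprn_ge0.
apply: ler_sum => s _; rewrite big_mkcond /=; apply: ler_sum => t _.
have term0 : 0 <= mu * X * ((1 / 2) ^+ s * (1 / 2) ^+ t).
  by rewrite !mulr_ge0 ?exprn_ge0.
case: ifP => // /andP[/andP[st ttau] t1].
have tlam : t%:R * lam <= 48 * n%:R by rewrite -ler_pdivlMr // tau_le.
have t8 : (8 * t <= n)%N.
  by rewrite -(ler_nat R) natrM; have := tau_le _ ttau; lra.
have := trapped_term_le p01 en muK k0 (ler0n R 48) st t1 t8 tlam.
rewrite -aE -/X -/mu => /(_ aL) /le_trans; apply.
rewrite mulrAC; apply: ler_wpM2l; first exact: mulr_ge0.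
rewrite (_ : 1 / 4 = 1 / 2 * (1 / 2)); last by lra.
rewrite exprMn; apply: ler_wpM2r; first exact: exprn_ge0.
by apply: ler_wiXn2l; rewrite ?(ltnW st) //; lra.
Qed.

(** * The two ranges of the density *)

Lemma isolated_pr_lower n p kap : (1 < n)%N -> 0 <= p <= 1 -> 0 <= kap ->
    n%:R * (1 - p) ^+ n.-1 <= expR kap ->
  n%:R * (1 - p) ^+ n.-1 <=
    (2 + 2 * expR kap) * gnp_pr (n := n) p (fun G => min_degree G == 0%N).
Proof.
move=> n1 p01 k0 muK; have := gnp_pr_isolated_sq p01 n1.
have /andP[p0 p1] := p01; have q0 : 0 <= 1 - p by lra.
set q := 1 - p in q0 muK *; set D := gnp_pr _ _; set mu := _ * q ^+ n.-1 in muK *.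
have D0 : 0 <= D by apply: gnp_pr_ge0.
have mu0 : 0 <= mu by rewrite mulr_ge0 ?exprn_ge0.
have eK0 := expR_ge0 kap.
have [->|mun0] := eqVneq mu 0; first by rewrite mulr_ge0 //; lra.
rewrite expr2 -mulrA ler_pM2l ?lt0r ?mun0 // => /le_trans; apply.
apply: ler_wpM2r => //.
suff : n.-1%:R * q ^+ n.-2 <= 1 + 2 * expR kap by lra.
have nn : n.-1 = n.-2.+1 by case: (n) n1 => [|[]].
(* for small q the bound on mu is useless, but then q ^ (n - 2) is tiny *)
have [q2|q2] := lerP (1 / 2) q.
  apply: (@le_trans _ _ (2 * mu)); last by lra.
  rewrite /mu mulrCA nn exprS; apply: ler_pM => //; first by rewrite exprn_ge0.
    by rewrite -nn ler_nat leq_pred.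
  rewrite mulrA -[X in X <= _]mul1r; apply: ler_wpM2r; first by rewrite exprn_ge0.
  by lra.
apply: (@le_trans _ _ 1); last by lra.
apply: (@le_trans _ _ ((2 ^ n.-2)%:R * (1 / 2) ^+ n.-2)).
  apply: ler_pM => //; first by rewrite exprn_ge0.
    by rewrite ler_nat nn ltn_expl.
  by apply: lerXn2r; rewrite ?nnegrE ?divr_ge0 // ltW.
by rewrite natrX -exprMn (_ : 2 * (1 / 2) = 1) ?expr1n //; lra.
Qed.

Lemma min_degree_pr_upper n p kap : (1 < n)%N -> 0 <= p <= 1 ->
    expR kap <= n%:R * (1 - p) ^+ n.-1 ->
  1 - gnp_pr (n := n) p (fun G => min_degree G == 0%N) <= expR (- kap) + p.
Proof.
move=> n1 p01 muK; have := gnp_pr_isolated_sq p01 n1.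
have /andP[p0 p1] := p01; have q0 : 0 <= 1 - p by lra.
set D := gnp_pr _ _; set mu := n%:R * _ in muK *.
have qp : 1 - p <= 1 by lra.
have D0 : 0 <= D by apply: gnp_pr_ge0.
have mu0 : 0 < mu by apply: lt_le_trans muK; apply: expR_gt0.
have eK0 := expR_ge0 (- kap).
rewrite expr2 -mulrA ler_pM2l // => /(ler_wpM2l q0).
have -> : (1 - p) * ((1 + n.-1%:R * (1 - p) ^+ n.-2) * D) =
    (1 - p + n.-1%:R * (1 - p) ^+ n.-1) * D.
  by rewrite (_ : n.-1 = n.-2.+1) ?exprS; [ring|case: (n) n1 => [|[]]].
have qmu : n.-1%:R * (1 - p) ^+ n.-1 <= mu.
  by apply: ler_wpM2r; rewrite ?exprn_ge0 // ler_nat leq_pred.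
have muE : 1 <= mu * expR (- kap).
  by rewrite expRN ler_pdivlMr ?expR_gt0 // mul1r.
move=> h; have qmu0 : 0 < 1 - p + mu by lra.
rewrite -(ler_pM2l qmu0).
have : (1 - p + n.-1%:R * (1 - p) ^+ n.-1) * D <= (1 - p + mu) * D.
  by apply: ler_wpM2r => //; lra.
have : 0 <= (1 - p) * expR (- kap) by rewrite mulr_ge0.
have : 0 <= (1 - p) * p by rewrite mulr_ge0.
by lra.
Qed.

(** 1 <= n q^(n-1) <= e^(lam - p (n-1)) forces p (n-1) <= lam, and n = e^lam is at
    least lam^2 / 2. *)
Lemma density_le n p lam : (1 < n)%N -> 0 <= p <= 1 -> 0 < lam ->
  expR lam = n%:R -> 1 <= n%:R * (1 - p) ^+ n.-1 -> p <= 4 / lam.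
Proof.
move=> n1 /andP[p0 p1] l0 en mu1; rewrite ler_pdivlMr //.
have n2R : 2 <= n%:R :> R by rewrite ler_nat.
have n1R : n.-1%:R = n%:R - 1 :> R by rewrite -[in RHS](prednK (ltnW n1)) -natr1 addrK.
have : 1 <= expR (lam - p * n.-1%:R).
  apply: le_trans mu1 _; rewrite expRD en; apply: ler_wpM2l => //.
  rewrite -mulNr expRM_natr; apply: lerXn2r; rewrite ?nnegrE ?expR_ge0; [lra|by []|].
  by have := expR_ge1Dx (- p).
rewrite -[X in X <= _]expR0 ler_expR n1R => h.
have ln : lam ^+ 2 / 2 <= n%:R.
  by rewrite -en; have := expR_ge1Dxn 1 (ltW l0); rewrite (_ : 2`! = 2)%N //; lra.
have pn : p * n%:R <= 2 * lam.
  by have : p * 2 <= p * n%:R by [rewrite ler_wpM2l|]; lra.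
rewrite -(ler_pM2l l0).
have : p * (lam ^+ 2 / 2) <= p * n%:R by rewrite ler_wpM2l.
by rewrite expr2; lra.
Qed.

(** Given [eps], choose kap so large that e^-kap is negligible, and only then the
    threshold on log n, which has to beat constants doubly exponential in kap. *)
Lemma gnp_pr_no_matching_negligible (eps : R) : 0 < eps -> exists N : nat,
  forall n p, (N <= n)%N -> ~~ odd n -> 0 <= p <= 1 ->
  gnp_pr (n := n) p (fun G => ~~ has_perfect_matching G && (min_degree G != 0%N)) <=
  eps * gnp_pr (n := n) p (fun G => min_degree G == 0%N).
Proof.
move=> eps0; pose e := Num.min eps 1.
have e0 : 0 < e by rewrite lt_min eps0 ltr01.
have e1 : e <= 1 by rewrite ge_min lexx orbT.
have ee : e <= eps by rewrite ge_min lexx.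
pose kap := 8 / e; pose a := kap + 202.
pose B := (2 + 2 * expR kap) * (1 + 4 * expR (a + expR a)).
pose L := 576 + 2 * a + 32 / e + 2 * B / e.
have k0 : 0 <= kap by rewrite divr_ge0 // ltW.
have eK0 := expR_ge0 kap.
have B0 : 0 <= B by rewrite mulr_ge0 ?addr_ge0 ?mulr_ge0 ?expR_ge0.
exists (Num.truncn (expR L)).+1 => n p Nn evn p01.
set D := gnp_pr _ (fun G => min_degree G == 0%N); suff h : gnp_pr p (fun G : {set {set 'I_n}} =>
    ~~ has_perfect_matching G && (min_degree G != 0%N)) <= e * D.
  by apply: le_trans h _; apply: ler_wpM2r ee; apply: gnp_pr_ge0.
have D0 : 0 <= D by apply: gnp_pr_ge0.
have nL : expR L < n%:R by apply: lt_le_trans (truncnS_gt _) _; rewrite ler_nat.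
have nR0 : 0 < n%:R :> R by apply: lt_trans nL; apply: expR_gt0.
pose lam : R := ln n%:R.
have en : expR lam = n%:R by rewrite /lam lnK.
have Llam : L <= lam by rewrite -ler_expR en ltW.
have e32 : 0 <= 32 / e by rewrite divr_ge0 // ltW.
have Be : 0 <= 2 * B / e by rewrite divr_ge0 ?mulr_ge0 // ltW.
have lam576 : 576 <= lam by rewrite /L /a in Llam; lra.
have lam0 : 0 < lam by lra.
have aL : kap + 202 <= lam / 2 by rewrite /L /a in Llam; lra.
have n1 : (1 < n)%N.
  by rewrite -(ltr_nat R) -en; have := expR_ge1Dx lam; lra.
have [muK|muK] := lerP (n%:R * (1 - p) ^+ n.-1) (expR kap).
- have Dmu := isolated_pr_lower n1 p01 k0 muK.
  apply: le_trans (gnp_pr_no_matching_le evn p01 en muK k0 aL lam576) _.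
  rewrite -/a -/D in Dmu *.
  set mu := n%:R * _ in Dmu *.
  have mu0 : 0 <= mu by rewrite mulr_ge0 ?exprn_ge0 //; case/andP: p01 => *; lra.
  have -> : (1 - p) ^+ n.-1 = mu * expR (- lam).
    by rewrite expRN en /mu mulrAC divff ?mul1r // gt_eqF.
  have half : expR (- (lam / 2)) <= 2 / lam.
    rewrite expRN -[_^-1]mul1r ler_pdivrMr ?expR_gt0 // mulrAC ler_pdivlMr // mul1r.
    by have := expR_ge1Dx (lam / 2); lra.
  have lamlam : expR (- lam) <= expR (- (lam / 2)) by rewrite ler_expR; lra.
  have -> : expR (a - lam / 2 + expR a) = expR (a + expR a) * expR (- (lam / 2)).
    by rewrite -expRD; congr expR; ring.
  have x0 := expR_ge0 (a + expR a).
  apply: (@le_trans _ _ (mu * ((1 + 4 * expR (a + expR a)) * (2 / lam)))).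
    rewrite -mulrDr; apply: ler_wpM2l => //.
    have := ler_wpM2l x0 half; lra.
  apply: (@le_trans _ _ ((2 + 2 * expR kap) * D *
      ((1 + 4 * expR (a + expR a)) * (2 / lam)))).
    by apply: ler_wpM2r Dmu; rewrite mulr_ge0 ?divr_ge0 ?addr_ge0 ?mulr_ge0 // ltW.
  rewrite (_ : _ * _ = 2 * B / lam * D); last by rewrite /B; ring.
  apply: ler_wpM2r => //; rewrite ler_pdivrMr // [e * _]mulrC -ler_pdivrMr //.
  by apply: le_trans Llam; rewrite /L /a; lra.
- have k1 : 1 <= expR kap by have := expR_ge1Dx kap; lra.
  have p4 := density_le n1 p01 lam0 en (le_trans k1 (ltW muK)).
  have D1 := min_degree_pr_upper n1 p01 (ltW muK); rewrite -/D in D1.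
  have eK : expR (- kap) <= e / 8.
    rewrite expRN -[_^-1]mul1r ler_pdivrMr ?expR_gt0 // mulrAC ler_pdivlMr // mul1r.
    have ke : e * kap = 8 by rewrite /kap mulrC divfK // gt_eqF.
    by have := ler_wpM2l (ltW e0) (expR_ge1Dx kap); lra.
  have pe : p <= e / 8.
    apply: le_trans p4 _; rewrite ler_pdivrMr //.
    have : 32 / e <= lam by apply: le_trans Llam; rewrite /L /a; lra.
    by rewrite ler_pdivrMr //; lra.
  have ND : gnp_pr p (fun G : {set {set 'I_n}} =>
    ~~ has_perfect_matching G && (min_degree G != 0%N)) <= 1 - D.
    have := gnp_pr_split p (fun=> true) (fun G : {set {set 'I_n}} => min_degree G == 0%N).
    rewrite gnp_pr_true /= -/D => ->; rewrite addrAC subrr add0r.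
    by apply: gnp_pr_mono => // G _ /andP[].
  have : e * (3 / 4) <= e * D by apply: ler_wpM2l; lra.
  by lra.
Qed.

End Estimates.

Local Open Scope classical_set_scope.
Local Open Scope ring_scope.

Theorem theorem2 (R : realType) (p : nat -> R)
    (hp : forall n : nat, 0 <= p n <= 1) :
  exists eps : nat -> R,
    (eps n @[n --> \oo] --> (0 : R)) /\
    (forall n : nat, ~~ odd n ->
       gnp_pr (n := n) (p n) (fun G => ~~ has_perfect_matching G) =
       (1 + eps n) * gnp_pr (n := n) (p n) (fun G => min_degree G == 0%N)).

Proof.
pose NP n := gnp_pr (n := n) (p n) (fun G => ~~ has_perfect_matching G).
pose D n := gnp_pr (n := n) (p n) (fun G => min_degree G == 0%N).
exists (fun n => if ~~ odd n && (D n != 0) then NP n / D n - 1 else 0); split.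
  apply/cvgrPdist_le => e e0.
  have [N hN] := gnp_pr_no_matching_negligible e0.
  exists N.+1 => // n /= Nn; rewrite sub0r normrN.
  case: ifP => [/andP[evn Dn0]|_]; last by rewrite normr0 ltW.
  have n0 : (0 < n)%N by apply: leq_ltn_trans Nn.
  have D0 : 0 <= D n by apply: gnp_pr_ge0.
  have -> : NP n = D n + gnp_pr (n := n) (p n)
      (fun G => ~~ has_perfect_matching G && (min_degree G != 0%N)).
    rewrite /NP (gnp_pr_split _ _ (fun G => min_degree G == 0%N)); congr (_ + _).
    rewrite /D !gnp_prE; apply: eq_bigr => G; rewrite powersetE => GE.
    have [d0|] := boolP (min_degree G == 0%N); last by rewrite andbF.
    by rewrite (isolated_no_perfect_matching _ GE d0) // card_ord.
  rewrite mulrDl divff // addrAC subrr add0r ger0_norm.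
    by rewrite ler_pdivrMr ?lt0r ?Dn0 //; apply: hN => //; apply: ltnW.
  by rewrite divr_ge0 // gnp_pr_ge0.
move=> n evn; rewrite evn /= -/(NP n) -/(D n).
have [D0|Dn0] := eqVneq (D n) 0; last by rewrite /= addrCA subrr addr0 divfK.
(* Pr(min degree = 0) vanishes only for the complete graph, that is for p = 1 *)
rewrite D0 mulr0 /NP; have [n0|n1] := leqP n 1.
  have {}n0 : n = 0%N by case: (n) n0 evn => [|[]].
  move: D0; rewrite /D; subst n; rewrite (_ : gnp_pr _ _ = gnp_pr (n := 0) (p 0%N) (fun=> true)).
    by rewrite gnp_pr_true => /eqP; rewrite oner_eq0.
  by apply: eq_bigl => G; rewrite /min_degree big_ord0 card_ord.
have := gnp_pr_isolated_sq (hp n) n1; rewrite -/(D n) D0 mulr0 => sq0.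
have := eq_le (0 : R) ((n%:R * (1 - p n) ^+ n.-1) ^+ 2).
rewrite sq0 sqr_ge0 eq_sym sqrf_eq0 mulf_eq0 pnatr_eq0 expf_eq0 => /orP[/eqP n0|/andP[_ /eqP q0]].
  by rewrite n0 in n1.
rewrite /gnp_pr big1 // => G /andP[]; rewrite powersetE => GE nM.
have /subsetPn[e eE eG] : ~~ (all_edges 'I_n \subset G).
  apply: contraNN nM => EG; rewrite (_ : G = all_edges 'I_n).
    by apply: complete_perfect_matching; rewrite card_ord.
  by apply/eqP; rewrite eqEsubset GE.
by rewrite /gnp_mass (bigD1 e) //= (negPf eG) q0 mul0r.
Qed.
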